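(* Fix a volume form-germ $\Omega$ at $0$ on $\mathbb C^r$. Let $A\in C^\infty(\mathbb C^r,\mathrm{Sym}_n)$ be symmetrically quasi-homogeneous. If $B\in C^\infty(\mathbb C^r,\mathrm{Sym}_n)$ is $\mathcal G$-equivalent to $A$, then $B$ is volume-preserving equivalent to $A$ (with respect to $\Omega$).
   Context: All germs are at $0\in\mathbb C^r$ and holomorphic. $\mathrm{Sym}_n$ and $\mathrm{GL}_n$ are the symmetric and the invertible complex $n\times n$ matrices; $C^\infty(\mathbb C^r,S)$ is the space of map-germs $(\mathbb C^r,0)\to S$ (value at $0$ arbitrary in $S$). A volume form-germ is a germ at $0$ of a holomorphic $r$-form not vanishing at $0$. $A,B\in C^\infty(\mathbb C^r,\mathrm{Sym}_n)$ are $\mathcal G$-equivalent if there exist a diffeomorphism-germ (biholomorphism-germ) $\Phi:(\mathbb C^r,0)\to(\mathbb C^r,0)$ and $X\in C^\infty(\mathbb C^r,\mathrm{GL}_n)$ with $B=X^T(A\circ\Phi)X$. They are volume-preserving equivalent if moreover $\Phi$ can be chosen with $\Phi^*\Omega=\Omega$. Symmetrical quasi-homogeneity: $A$ is symmetrically quasi-homogeneous if there exist a coordinate system $(x_1,\dots,x_r)$ on $(\mathbb C^r,0)$ (centred at $0$), non-negative integers $\lambda_1,\dots,\lambda_r$ with $\sum_k\lambda_k>0$, non-negative integers $\delta_1,\dots,\delta_n$, and $X\in C^\infty(\mathbb C^r,\mathrm{GL}_n)$ such that $B=X^TAX$ satisfies $$B_{ij}(t^{\lambda_1}x_1,\dots,t^{\lambda_r}x_r)=t^{\frac12(\delta_i+\delta_j)}B_{ij}(x_1,\dots,x_r)\quad\text{for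 all } t\in\mathbb C,\ i,j=1,\dots,n$$ (for $x$ and $(t^{\lambda_k}x_k)$ in a sufficiently small neighbourhood of $0$; $t^0=1$). When $\delta_i+\delta_j$ is odd, the condition is understood as $B_{ij}\equiv 0$. *)

(* Defs.v *)
From HB Require Import structures.
From mathcomp Require Import all_boot all_order all_algebra.
From mathcomp Require Import complex.
From mathcomp Require Import boolp classical_sets functions reals.
From mathcomp Require Import topology normedtype derive.

Set Implicit Arguments.
Unset Strict Implicit.
Unset Printing Implicit Defensive.

Import Order.TTheory GRing.Theory Num.Theory.
Import numFieldNormedType.Exports.

Local Open Scope classical_set_scope.
Local Open Scope ring_scope.
Local Open Scope complex_scope.

(* The library gives [R[i]^o] the topology and norm of the modulus; this makes
   them available on [R[i]] itself, and hence on matrices over it. *)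
HB.instance Definition _ (R : realType) := NormedModule.copy R[i] R[i]^o.

(* The complex numbers are [R[i]] for [R : realType], and points of C^r are row
   vectors.  A germ at 0 is given by a total function representing it; every
   notion below depends only on its values near 0. *)

Section Germs.
Variables (R : realType) (r : nat).
Local Notation C := R[i].
Local Notation Cr := 'rV[C]_r.

(* [differentiable] is Frechet differentiability over the field C, so this says
   that f is complex differentiable on a neighbourhood of 0. *)
Definition holomorphic_germ (W : normedModType C) (f : Cr -> W) : Prop :=
  \forall x \near (0 : Cr), differentiable f x.

Definition map_germ (W : normedModType C) (S : set W) (f : Cr -> W) : Prop :=
  holomorphic_germ f /\ \forall x \near (0 : Cr), S (f x).

Definition biholomorphism_germ (Phi : Cr -> Cr) : Prop :=
  [/\ holomorphic_germ Phi, Phi 0 = 0 &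
      exists Psi : Cr -> Cr,
        [/\ holomorphic_germ Psi, Psi 0 = 0,
            \forall x \near (0 : Cr), Psi (Phi x) = x &
            \forall x \near (0 : Cr), Phi (Psi x) = x]].

Definition multilinear (a : ('I_r -> Cr) -> C) : Prop :=
  forall (v : 'I_r -> Cr) (i : 'I_r) (c : C) (u w : Cr),
    a (fun j => if j == i then c *: u + w else v j) =
    c * a (fun j => if j == i then u else v j) +
    a (fun j => if j == i then w else v j).

Definition alternating (a : ('I_r -> Cr) -> C) : Prop :=
  forall (v : 'I_r -> Cr) (i j : 'I_r), i != j -> v i = v j -> a v = 0.

(* [Omega x v] is the value of the r-form at the point x on the r tangent
   vectors v. *)
Definition volume_form_germ (Omega : Cr -> ('I_r -> Cr) -> C) : Prop :=
  [/\ \forall x \near (0 : Cr), multilinear (Omega x) /\ alternating (Omega x),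
      forall v : 'I_r -> Cr, holomorphic_germ (fun x => Omega x v) &
      exists v : 'I_r -> Cr, Omega 0 v != 0].

Definition pullback (Phi : Cr -> Cr) (Omega : Cr -> ('I_r -> Cr) -> C) :
    Cr -> ('I_r -> Cr) -> C :=
  fun x v => Omega (Phi x) (fun k => 'd Phi x (v k)).

Definition preserves_form (Omega : Cr -> ('I_r -> Cr) -> C) (Phi : Cr -> Cr) :
    Prop :=
  \forall x \near (0 : Cr), pullback Phi Omega x = Omega x.

End Germs.

Section Equivalence.
Variables (R : realType) (r n : nat).
Local Notation C := R[i].
Local Notation Cr := 'rV[C]_r.

Definition sym_mx : set 'M[C]_n := [set M | M^T = M].
Definition GL_mx : set 'M[C]_n := [set M | M \in unitmx].

Definition G_equivalent_via (Phi : Cr -> Cr) (X A B : Cr -> 'M[C]_n) : Prop :=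
  [/\ biholomorphism_germ Phi, map_germ GL_mx X &
      \forall x \near (0 : Cr), B x = (X x)^T *m A (Phi x) *m X x].

Definition G_equivalent (A B : Cr -> 'M[C]_n) : Prop :=
  exists (Phi : Cr -> Cr) (X : Cr -> 'M[C]_n), G_equivalent_via Phi X A B.

Definition volume_preserving_equivalent (Omega : Cr -> ('I_r -> Cr) -> C)
    (A B : Cr -> 'M[C]_n) : Prop :=
  exists (Phi : Cr -> Cr) (X : Cr -> 'M[C]_n),
    G_equivalent_via Phi X A B /\ preserves_form Omega Phi.

(* The coordinate system is the biholomorphism-germ chi: the coordinates of a
   point p are the entries [chi p 0 k].  The value of B_ij at coordinates
   (t^lambda_k x_k)_k is thus its value at the point q whose coordinates are
   those, where x_k are the coordinates of p.  Note that [0 ^+ 0 = 1]. *)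
Definition symmetrically_quasi_homogeneous (A : Cr -> 'M[C]_n) : Prop :=
  exists (chi : Cr -> Cr) (lambda : 'I_r -> nat) (delta : 'I_n -> nat)
         (X : Cr -> 'M[C]_n),
    [/\ biholomorphism_germ chi, (0 < \sum_k lambda k)%N, map_germ GL_mx X &
        let B x := (X x)^T *m A x *m X x in
        exists2 U : set Cr, nbhs (0 : Cr) U &
          forall i j : 'I_n,
            if odd (delta i + delta j) then forall p, U p -> B p i j = 0
            else forall (t : C) (p q : Cr), U p -> U q ->
              (forall k, chi q 0 k = t ^+ lambda k * chi p 0 k) ->
              B q i j = t ^+ (delta i + delta j)./2 * B p i j].

End Equivalence.

Arguments sym_mx {R n}.
Arguments GL_mx {R n}.

(* Main.v *)
From HB Require Import structures.
Require Import Defs.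
From mathcomp Require Import all_boot all_order all_algebra fingroup perm.
From mathcomp Require Import complex.
From mathcomp Require Import boolp classical_sets functions reals constructive_ereal.
From mathcomp Require Import topology normedtype derive.
From mathcomp Require Import sequences realfun exp trigo measure lebesgue_measure.
From mathcomp Require Import lebesgue_integral ftc.
From mathcomp Require Import ring lra.
Import Order.TTheory GRing.Theory Num.Theory.
Import numFieldNormedType.Exports.
Local Open Scope classical_set_scope.
Local Open Scope ring_scope.
Local Open Scope complex_scope.

Set Implicit Arguments.
Unset Strict Implicit.
Unset Printing Implicit Defensive.

(** In coordinates where [A] is quasi-homogeneous with weights [lambda], every
scaling [Th x = (s x ^ m_k * x_k)_k] with [m_k = 2 lambda_k] and [s 0 != 0] is a
symmetry of [A] up to congruence, by the diagonal matrix of the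
[s x ^ delta_i].  It is therefore enough to find such a [Th] carrying one volume
form [f dx] to another one [g dx].  Let [E] be the Euler field of the weights
[m] and [M] their sum.  The function [h_f x = \int_0^1 t^(M-1) f (t^m x) dt]
solves [(E + M) h_f = f], and applying [E + M] to the scalar equation
[h_f (Th x) * s x ^ M = h_g x] yields exactly [f (Th x) * det (D Th) = g x];
the scalar equation is solved for [s] by the implicit function theorem.

The densities [f] and [g] involve Jacobians of maps that are only assumed
complex differentiable, so the argument rests on Goursat's theorem: a holomorphic
derivative is a mean over a circle, which gives Cauchy estimates, the
holomorphy of integrals depending on a parameter, and hence that of the
derivative itself. *)

(** The scalar equation for [s] compares primitives. Since (E + M) h dx = d (i_E (h dx)), the form
    i_E (h_f dx) is a primitive of f dx. As [Th] moves points along the orbits of the weighted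
    action, it sends E to a multiple of E, by the factor 1 + s^-1 E s, and the same factor occurs in
    det (D Th) = s^M (1 + s^-1 E s). The two cancel: the pullback of i_E (h_f dx) by [Th] is h_f (Th
    x) s^M i_E dx, where no derivative of s is left. A differential equation for s thus becomes an
    implicit one, and no flow has to be integrated.

    The weights are doubled because t ^ ((delta_i + delta_j) / 2) splits into a factor for i and a
    factor for j only after t = s^2. The condition that the sum of the weights is positive enters
    through M h_f 0 = f 0: it gives h_f 0 != 0, so that s 0 can be an M-th root of h_g 0 / h_f 0.
    This root is an arbitrary non-zero complex number, which is why the homogeneity is used for all
    complex t and not only for t near 1. *)

Local Notation Re := complex.Re.
Local Notation Im := complex.Im.

(** * Integrals of complex-valued functions of a real variable *)

Section ComplexNorm.
Variable R : realType.
Implicit Types z : R[i].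

Lemma normr_Re_le z : (`|Re z|)%:C <= `|z|.
Proof.
rewrite normc_def lecR -sqrtr_sqr ler_wsqrtr // lerDl; exact: sqr_ge0.
Qed.

Lemma normr_Im_le z : (`|Im z|)%:C <= `|z|.
Proof.
rewrite normc_def lecR -sqrtr_sqr ler_wsqrtr // lerDr; exact: sqr_ge0.
Qed.

Lemma normr_le_ReIm z : `|z| <= (`|Re z| + `|Im z|)%:C.
Proof.
rewrite {1}(complexE z) (le_trans (ler_normD _ _))// rmorphD normrM.
by rewrite !normc_def /= !expr0n /= !expr1n add0r !addr0 sqrtr1 mul1r !sqrtr_sqr.
Qed.

Lemma normr_real_complex (x : R) : `|x%:C| = `|x|%:C.
Proof. by rewrite normc_def /= expr0n /= addr0 sqrtr_sqr. Qed.

Lemma ReD z1 z2 : Re (z1 + z2) = Re z1 + Re z2.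
Proof. by case: z1; case: z2. Qed.
Lemma ImD z1 z2 : Im (z1 + z2) = Im z1 + Im z2.
Proof. by case: z1; case: z2. Qed.
Lemma ReB z1 z2 : Re (z1 - z2) = Re z1 - Re z2.
Proof. by case: z1; case: z2. Qed.
Lemma ImB z1 z2 : Im (z1 - z2) = Im z1 - Im z2.
Proof. by case: z1; case: z2. Qed.
Lemma ReM z1 z2 : Re (z1 * z2) = Re z1 * Re z2 - Im z1 * Im z2.
Proof. by case: z1; case: z2. Qed.
Lemma ImM z1 z2 : Im (z1 * z2) = Re z1 * Im z2 + Im z1 * Re z2.
Proof. by case: z1; case: z2. Qed.

Lemma gt0_Re (e : R[i]) : 0 < e -> e = (Re e)%:C /\ 0 < Re e.
Proof. by case: e => a b; rewrite ltcE /= => /andP[/eqP -> ->]. Qed.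

Lemma ge0_Re (e : R[i]) : 0 <= e -> e = (Re e)%:C /\ 0 <= Re e.
Proof. by case: e => a b; rewrite lecE /= => /andP[/eqP -> ->]. Qed.

Lemma continuous_Re : continuous (@Re R : R[i] -> R).
Proof.
move=> z; apply/(cvgrPdist_lt (FF := nbhs_filter z)) => e e0.
apply/nbhs_ballP; exists e%:C; rewrite /= ?ltcR// => w zw.
by rewrite -ReB -ltcR (le_lt_trans (normr_Re_le _)).
Qed.

Lemma continuous_Im : continuous (@Im R : R[i] -> R).
Proof.
move=> z; apply/(cvgrPdist_lt (FF := nbhs_filter z)) => e e0.
apply/nbhs_ballP; exists e%:C; rewrite /= ?ltcR// => w zw.
by rewrite -ImB -ltcR (le_lt_trans (normr_Im_le _)).
Qed.

Lemma cvg_complex T (F : set_system T) (FF : Filter F) (f : T -> R[i]) (l : R[i]) :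
  Re (f x) @[x --> F] --> Re l -> Im (f x) @[x --> F] --> Im l -> f @ F --> l.
Proof.
move=> /cvgrPdist_lt fr /cvgrPdist_lt fi; apply/cvgrPdist_lt => e /gt0_Re[-> e0].
near=> x; rewrite (le_lt_trans (normr_le_ReIm _))// ltcR ReB ImB.
rewrite [ltRHS]splitr ltrD//; near: x; [apply: fr | apply: fi]; exact: divr_gt0.
Unshelve. all: by end_near. Qed.

Lemma continuous_real_complex : continuous (fun x : R => x%:C).
Proof. by move=> x; apply: cvg_complex; [exact: cvg_id | exact: cvg_cst]. Qed.

End ComplexNorm.

Section ComplexIntegral.
Variable R : realType.
Notation mu := (@lebesgue_measure R).
Implicit Types (a b c : R) (f g : R -> R[i]).

(** This is an integral over a set, hence unoriented: it is 0 when [b < a], and the rules below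
    assume ordered bounds where orientation would matter. *)
Definition cint a b f : R[i] :=
  (\int[mu]_(x in `[a, b]) Re (f x)) +i* (\int[mu]_(x in `[a, b]) Im (f x)).

(** Continuity is two-sided even at the end points: the integrands are always defined and continuous
    beyond the interval. *)
Definition continuous_itv a b f := forall x, x \in `[a, b] -> {for x, continuous f}.

Lemma continuous_itvD a b f g : continuous_itv a b f -> continuous_itv a b g ->
  continuous_itv a b (fun x => f x + g x).
Proof. by move=> cf cg x xab; apply: continuousD; [exact: cf|exact: cg]. Qed.

Lemma continuous_itvN a b f : continuous_itv a b f ->
  continuous_itv a b (fun x => - f x).
Proof. by move=> cf x xab; apply: continuousN; exact: cf. Qed.

Lemma continuous_itv_cst a b (z : R[i]) : continuous_itv a b (fun=> z).
Proof. by move=> x _; exact: cst_continuous. Qed.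

Lemma continuous_itvZ a b (z : R[i]) f : continuous_itv a b f ->
  continuous_itv a b (fun x => z * f x).
Proof.
by move=> cf x xab; apply: continuousM; [exact: cst_continuous|exact: cf].
Qed.

Lemma within_Re a b f : continuous_itv a b f ->
  {within `[a, b], continuous (fun x => Re (f x))}.
Proof.
move=> cf; apply: continuous_in_subspaceT => x /set_mem xab.
by apply: (@continuous_comp _ _ _ f); [exact: cf | exact: continuous_Re].
Qed.

Lemma within_Im a b f : continuous_itv a b f ->
  {within `[a, b], continuous (fun x => Im (f x))}.
Proof.
move=> cf; apply: continuous_in_subspaceT => x /set_mem xab.
by apply: (@continuous_comp _ _ _ f); [exact: cf | exact: continuous_Im].
Qed.

Lemma integrable_Re a b f : continuous_itv a b f ->
  mu.-integrable `[a, b] (EFin \o (fun x => Re (f x))).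
Proof.
move=> cf; apply: continuous_compact_integrable; first exact: segment_compact.
exact: within_Re.
Qed.

Lemma integrable_Im a b f : continuous_itv a b f ->
  mu.-integrable `[a, b] (EFin \o (fun x => Im (f x))).
Proof.
move=> cf; apply: continuous_compact_integrable; first exact: segment_compact.
exact: within_Im.
Qed.

Lemma eq_cint a b f g : (forall x, x \in `[a, b] -> f x = g x) ->
  cint a b f = cint a b g.
Proof.
by move=> fg; rewrite /cint; congr (_ +i* _); apply: eq_Rintegral => x /set_mem xab;
  rewrite fg.
Qed.

Lemma cintD a b f g : continuous_itv a b f -> continuous_itv a b g ->
  cint a b (fun x => f x + g x) = cint a b f + cint a b g.
Proof.
move=> cf cg; rewrite /cint.
rewrite -[RHS]/(_ +i* _); congr (_ +i* _).
  rewrite -RintegralD//; [|exact: integrable_Re..].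
  by apply: eq_Rintegral => x _; rewrite ReD.
rewrite -RintegralD//; [|exact: integrable_Im..].
by apply: eq_Rintegral => x _; rewrite ImD.
Qed.

Lemma cintZ a b (z : R[i]) f : continuous_itv a b f ->
  cint a b (fun x => z * f x) = z * cint a b f.
Proof.
case: z => u v cf; rewrite /cint -[RHS]/(_ +i* _).
have ir := integrable_Re cf; have ii := integrable_Im cf.
have m := measurable_itv `[a, b].
have iZ k (h : R -> R) : mu.-integrable `[a, b] (EFin \o h) ->
    mu.-integrable `[a, b] (EFin \o (fun x => k * h x)) by exact: integrableZl.
congr (_ +i* _).
  rewrite -!RintegralZl// -RintegralB//; [|exact: iZ..].
  by apply: eq_Rintegral => x _; rewrite ReM.
rewrite -!RintegralZl// -RintegralD//; [|exact: iZ..].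
by apply: eq_Rintegral => x _; rewrite ImM.
Qed.

Lemma cintB a b f g : continuous_itv a b f -> continuous_itv a b g ->
  cint a b (fun x => f x - g x) = cint a b f - cint a b g.
Proof.
move=> cf cg; rewrite (cintD cf (continuous_itvN cg)).
congr (_ + _); rewrite -mulN1r -(cintZ _ cg); apply: eq_cint => x _.
by rewrite mulN1r.
Qed.

(** The factor 2 comes from bounding the real and imaginary parts separately. Later estimates need
    some constant, not the best one. *)
Lemma cint_le a b f (M : R[i]) : a <= b -> continuous_itv a b f ->
  (forall x, x \in `[a, b] -> `|f x| <= M) ->
  `|cint a b f| <= 2 * M * (b - a)%:C.
Proof.
move=> ab cf fM.
have M0 : 0 <= M by apply: le_trans (fM a _); rewrite ?in_itv/= ?lexx.
have [ME _] := ge0_Re M0; rewrite ME in fM *.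
have m := measurable_itv `[a, b].
have key (h : R -> R) : mu.-integrable `[a, b] (EFin \o h) ->
    (forall x, x \in `[a, b] -> `|h x| <= Re M) ->
    `|\int[mu]_(x in `[a, b]) h x| <= Re M * (b - a).
  move=> ih hM; rewrite (le_trans (le_normr_Rintegral _ _))//.
  have -> : Re M * (b - a) = \int[mu]_(x in `[a, b]) Re M.
    rewrite Rintegral_cst//; congr (_ * _).
    transitivity (fine (mu `[a, b])); last by [].
    rewrite (lebesgue_measure_itv `[a, b]) /= lte_fin.
    by case: ltP => //= ba; rewrite (@le_anti _ _ a b) ?subrr// ab.
  apply: le_Rintegral => //; first exact: integrable_norm.
  by apply: continuous_compact_integrable; [exact: segment_compact |
    exact/continuous_subspaceT/cst_continuous].
rewrite (le_trans (normr_le_ReIm _))// -[2]/(2%:R) -(rmorph_nat (real_complex R)).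
rewrite -!rmorphM lecR /= -mulrA mulr_natl mulr2n lerD//.
  apply: key; first exact: integrable_Re.
  by move=> x xab; rewrite -lecR (le_trans (normr_Re_le _))// fM.
apply: key; first exact: integrable_Im.
by move=> x xab; rewrite -lecR (le_trans (normr_Im_le _))// fM.
Qed.

Lemma cint_chasles a b c f : a <= c -> c <= b -> continuous_itv a b f ->
  cint a b f = cint a c f + cint c b f.
Proof.
move=> ac cb cf; rewrite /cint -[RHS]/(_ +i* _).
have itvE (h : R -> R) : mu.-integrable `[a, b] (EFin \o h) ->
    \int[mu]_(x in `[a, b]) h x =
    \int[mu]_(x in `[a, c]) h x + \int[mu]_(x in `[c, b]) h x.
  move=> ih; rewrite -(@Rintegral_itv_obnd_cbnd _ c); last first.
    apply: integrableS ih => //=.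
    by apply: subset_itv; rewrite ?bnd_simp.
  by rewrite -(@Rintegral_itvB _ h (BLeft a))// ?bnd_simp// addrC subrK.
by congr (_ +i* _); apply: itvE; [exact: integrable_Re | exact: integrable_Im].
Qed.

Lemma cint_point a f : cint a a f = 0.
Proof. by rewrite /cint set_itv1 !Rintegral_set1. Qed.

Lemma cint_FTC a b f g : a <= b -> continuous_itv a b g ->
  (forall x, x \in `[a, b] -> is_derive x 1 (fun t => Re (f t)) (Re (g x)) /\
     is_derive x 1 (fun t => Im (f t)) (Im (g x))) ->
  cint a b g = f b - f a.
Proof.
rewrite le_eqVlt => /predU1P[<- _ _|ab cg dfg]; first by rewrite subrr cint_point.
have key (h k : R -> R) : {within `[a, b], continuous k} ->
    (forall x, x \in `[a, b] -> is_derive x 1 h (k x)) ->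
    \int[mu]_(x in `[a, b]) k x = h b - h a.
  move=> ck dh; rewrite /Rintegral (continuous_FTC2 ab ck _ _ (F := h))//.
    have ch x : x \in `[a, b] -> {for x, continuous h}.
      move=> /dh dx; apply: differentiable_continuous; exact/derivable1_diffP.
    split.
    - by move=> x xab; have [] := dh x (subset_itv_oo_cc xab).
    - apply: cvg_at_right_filter; apply: ch.
      by rewrite in_itv/= lexx ltW.
    - apply: cvg_at_left_filter; apply: ch.
      by rewrite in_itv/= lexx ltW.
  by move=> x /subset_itv_oo_cc /dh dx; rewrite derive1E derive_val.
have kr := key (fun t => Re (f t)) _ (within_Re cg) (fun x xab => (dfg x xab).1).
have ki := key (fun t => Im (f t)) _ (within_Im cg) (fun x xab => (dfg x xab).2).
by rewrite /cint kr ki; case: (f b) => ? ?; case: (f a).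
Qed.

End ComplexIntegral.

(** * Complex differentials along lines *)

Section Line.
Variable R : realType.
Variable V : normedModType R[i].

Lemma diff_cvg_scale (W : normedModType R[i]) (f : V -> W) (x v : V) : differentiable f x ->
  (h^-1 *: (f (x + h *: v) - f x)) @[h --> (0 : R[i])^'] --> 'd f x v.
Proof.
move=> df; have dv := @diff_derivable _ _ _ f x v df; rewrite -(deriveE v df).
suff -> : (fun h : R[i] => h^-1 *: (f (x + h *: v) - f x)) =
  (fun h => h^-1 *: ((f \o shift x) (h *: v) - f x)) by [].
by apply/funext => h; rewrite /= [x + _]addrC.
Qed.

Lemma diff_cvg (f : V -> R[i]) (x v : V) : differentiable f x ->
  (h^-1 * (f (x + h *: v) - f x)) @[h --> (0 : R[i])^'] --> 'd f x v.
Proof. exact: diff_cvg_scale. Qed.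

(** The working tool for computing differentials: once differentiability is known, the value on a
    vector is read off from any limit of the difference quotient. *)
Lemma diff_cvg_unique (f : V -> R[i]) (x v : V) (l : R[i]) : differentiable f x ->
  (h^-1 * (f (x + h *: v) - f x)) @[h --> (0 : R[i])^'] --> l -> 'd f x v = l.
Proof.
move=> /(@diff_cvg _ x v) dv dl.
by rewrite -(cvg_lim (@norm_hausdorff _ R[i]) dl) (cvg_lim (@norm_hausdorff _ R[i]) dv).
Qed.

(** Lets the increment of a complex difference quotient be restricted to real values, which opens
    the way to the real fundamental theorem of calculus and mean value theorem. *)
Lemma cvg_dnbhs_real_complex : (h%:C) @[h --> (0 : R)^'] --> (0 : R[i])^'.
Proof.
move=> A; rewrite /= => -[e /gt0_Re[eE e0] eA].
exists (Re e) => // h /= h0 hn0; apply: eA => /=.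
  move: h0; rewrite !sub0r !normrN => h0.
  by rewrite normr_real_complex eE ltcR.
by apply: contra_neq hn0 => -[].
Qed.

Lemma is_derive_Re_line (f : V -> R[i]) (p v : V) (t : R) :
  differentiable f (p + t%:C *: v) ->
  is_derive t 1 (fun s : R => Re (f (p + s%:C *: v))) (Re ('d f (p + t%:C *: v) v)).
Proof.
move=> /(@diff_cvg _ _ v) dv.
have /cvg_comp/(_ (@continuous_Re R _)) := cvg_comp _ _ cvg_dnbhs_real_complex dv.
set l := Re _ => c.
have {}c : h^-1 *: (Re (f (p + (h *: 1 + t)%:C *: v)) - Re (f (p + t%:C *: v)))
   @[h --> 0^'] --> l.
  apply: cvg_trans c; apply: near_eq_cvg; near=> h.
  rewrite /= -fmorphV ReM /= mul0r subr0 ReB; congr (_ * (Re (f _) - _)).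
  by rewrite -addrA -scalerDl -rmorphD [h *: 1]mulr1 [t + h]addrC.
by split; [apply/cvg_ex; exists l | exact: cvg_lim c].
Unshelve. all: by end_near. Qed.

Lemma is_derive_Im_line (f : V -> R[i]) (p v : V) (t : R) :
  differentiable f (p + t%:C *: v) ->
  is_derive t 1 (fun s : R => Im (f (p + s%:C *: v))) (Im ('d f (p + t%:C *: v) v)).
Proof.
move=> /(@diff_cvg _ _ v) dv.
have /cvg_comp/(_ (@continuous_Im R _)) := cvg_comp _ _ cvg_dnbhs_real_complex dv.
set l := Im _ => c.
have {}c : h^-1 *: (Im (f (p + (h *: 1 + t)%:C *: v)) - Im (f (p + t%:C *: v)))
   @[h --> 0^'] --> l.
  apply: cvg_trans c; apply: near_eq_cvg; near=> h.
  rewrite /= -fmorphV ImM /= mul0r addr0 ImB; congr (_ * (Im (f _) - _)).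
  by rewrite -addrA -scalerDl -rmorphD [h *: 1]mulr1 [t + h]addrC.
by split; [apply/cvg_ex; exists l | exact: cvg_lim c].
Unshelve. all: by end_near. Qed.

End Line.

(** * Nested rectangles *)

Section Bisection.
Variable R : realType.

Lemma lt_halving (w e : R) : 0 < e -> exists n : nat, w / 2 ^+ n < e.
Proof.
move=> e0; have [n wn] : exists n : nat, w / e < n%:R.
  exists (Num.bound `|w / e|).
  exact: le_lt_trans (ler_norm _) (archi_boundP (normr_ge0 _)).
exists n; rewrite ltr_pdivrMr ?exprn_gt0// mulrC -ltr_pdivrMr//.
rewrite (lt_trans wn)// -natrX ltr_nat; exact: ltn_expl.
Qed.

Lemma nested_intervals (u v : nat -> R) : (forall n, u n <= v n) ->
  (forall n, u n <= u n.+1) -> (forall n, v n.+1 <= v n) ->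
  exists x, forall n, u n <= x <= v n.
Proof.
move=> uv uS vS; have um : {homo u : n m / (n <= m)%N >-> n <= m}.
  exact: (homo_leq lexx le_trans).
have vm : {homo v : n m / (n <= m)%N >-> m <= n}.
  by apply: (homo_leq (r := fun x y : R => y <= x)) => // y x z xy yz; exact: le_trans yz xy.
have umv m n : u m <= v n.
  rewrite (le_trans (um _ _ (leq_maxl m n)))// (le_trans (uv _))//.
  exact: vm (leq_maxr m n).
exists (sup (range u)) => n; apply/andP; split.
  by apply: ub_le_sup; [exists (v 0%N) => _ [m _ <-] | exists n].
by apply: ge_sup; [exists (u 0%N), 0%N | move=> _ [m _ <-]].
Qed.

(** Compactness as an induction principle. If [P] failed on the whole rectangle, it would fail on
    one of its quarters, and so on; the nested quarters shrink to a point, where the local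
    hypothesis contradicts the failure. *)
Lemma rectangle_bisection (P : R -> R -> R -> R -> Prop) (a b c d : R) :
  a <= b -> c <= d ->
  (forall a' b' c' d', a <= a' -> a' <= b' -> b' <= b ->
     c <= c' -> c' <= d' -> d' <= d ->
     let m := (a' + b') / 2 in let n := (c' + d') / 2 in
     P a' m c' n -> P m b' c' n -> P a' m n d' -> P m b' n d' -> P a' b' c' d') ->
  (forall x y, a <= x <= b -> c <= y <= d -> exists2 e, 0 < e &
     forall a' b' c' d', a <= a' -> a' <= x <= b' -> b' <= b ->
     c <= c' -> c' <= y <= d' -> d' <= d -> b' - a' < e -> d' - c' < e ->
     P a' b' c' d') ->
  P a b c d.
Proof.
move=> ab cd split_P loc_P; apply: contrapT => nP.
pose good (q : R * R * R * R) := let: (a', b', c', d') := q in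
  [/\ a <= a' <= b', b' <= b, c <= c' <= d', d' <= d & ~ P a' b' c' d'].
pose child (q q' : R * R * R * R) :=
  let: (a1, b1, c1, d1) := q in let: (a2, b2, c2, d2) := q' in
  [/\ a1 <= a2, b2 <= b1, c1 <= c2, d2 <= d1 &
      b2 - a2 = (b1 - a1) / 2 /\ d2 - c2 = (d1 - c1) / 2].
(* Stating this as an implication makes the choice function total on quadruples, as dependent choice
   requires. *)
have step q : {q' | good q -> good q' /\ child q q'}.
  apply: cid; case: q => [[[a1 b1] c1] d1].
  have [[/andP[aa1 ab1] bb1 /andP[cc1 cd1] dd1 nP1]|?] :=
    pselect (good (a1, b1, c1, d1)); last by exists (a1, b1, c1, d1).
  pose m := (a1 + b1) / 2; pose n := (c1 + d1) / 2.
  have am : a1 <= m by rewrite /m; lra.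
  have mb : m <= b1 by rewrite /m; lra.
  have cn : c1 <= n by rewrite /n; lra.
  have nd : n <= d1 by rewrite /n; lra.
  have [P1|P1] := pselect (P a1 m c1 n); last first.
    by exists (a1, m, c1, n); split; split=> //; rewrite ?(aa1,cc1)//=; rewrite /m /n; try lra; split; lra.
  have [P2|P2] := pselect (P m b1 c1 n); last first.
    by exists (m, b1, c1, n); split; split=> //; rewrite ?(cc1)//=; rewrite /m /n; try lra; split; lra.
  have [P3|P3] := pselect (P a1 m n d1); last first.
    by exists (a1, m, n, d1); split; split=> //; rewrite ?(aa1)//=; rewrite /m /n; try lra; split; lra.
  have [P4|P4] := pselect (P m b1 n d1); last first.
    by exists (m, b1, n, d1); split; split=> //; rewrite /m /n; try lra; split; lra.
  by case: nP1; apply: split_P.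
have [f [f0 fS]] := dependent_choice step (a, b, c, d).
have gf n : good (f n).
  elim: n => [|n ih]; last by have [] := fS n ih.
  by rewrite f0; split; rewrite ?lexx.
have cf n := (fS n (gf n)).2.
pose fa n := (f n).1.1.1; pose fb n := (f n).1.1.2; pose fc n := (f n).1.2; pose fd n := (f n).2.
have fE n : f n = (fa n, fb n, fc n, fd n).
  by rewrite /fa /fb /fc /fd; case: (f n) => [[[]]].
have G n : [/\ a <= fa n <= fb n, fb n <= b, c <= fc n <= fd n, fd n <= d
    & ~ P (fa n) (fb n) (fc n) (fd n)].
  by have := gf n; rewrite fE.
have Ch n : [/\ fa n <= fa n.+1, fb n.+1 <= fb n, fc n <= fc n.+1, fd n.+1 <= fd n &
    fb n.+1 - fa n.+1 = (fb n - fa n) / 2 /\ fd n.+1 - fc n.+1 = (fd n - fc n) / 2].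
  by have := cf n; rewrite (fE n) (fE n.+1).
have [x xE] : exists x, forall n, fa n <= x <= fb n.
  by apply: nested_intervals => n; have [/andP[] //] := G n; have [] := Ch n.
have [y yE] : exists y, forall n, fc n <= y <= fd n.
  by apply: nested_intervals => n; have [_ _ /andP[] //] := G n; have [] := Ch n.
have Wb n : fb n - fa n = (b - a) / 2 ^+ n.
  elim: n => [|n ih]; first by rewrite /fb /fa f0 /= expr0 divr1.
  by have [_ _ _ _ [-> _]] := Ch n; rewrite ih exprSr invfM mulrA.
have Wd n : fd n - fc n = (d - c) / 2 ^+ n.
  elim: n => [|n ih]; first by rewrite /fd /fc f0 /= expr0 divr1.
  by have [_ _ _ _ [_ ->]] := Ch n; rewrite ih exprSr invfM mulrA.
have [||e e0 eP] := loc_P x y.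
- by have := xE 0%N; rewrite /fa /fb f0.
- by have := yE 0%N; rewrite /fc /fd f0.
have [n ne] := lt_halving (Num.max (b - a) (d - c)) e0.
have [/andP[? ?] ? /andP[? ?] ? []] := G n; apply: eP => //.
  by rewrite Wb (le_lt_trans _ ne)// ler_pM2r ?invr_gt0 ?exprn_gt0// le_max lexx.
by rewrite Wd (le_lt_trans _ ne)// ler_pM2r ?invr_gt0 ?exprn_gt0// le_max lexx orbT.
Qed.

End Bisection.

(** * Goursat's theorem on rectangles *)

Section Goursat.
Variable R : realType.
Implicit Types (F G : R[i] -> R[i]) (a b c d : R).

Lemma cartesianE (x y : R) : x +i* y = x%:C + 'i * y%:C.
Proof. exact: complexE. Qed.

Lemma continuous_horizontal F (x y : R) : {for x +i* y, continuous F} ->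
  {for x, continuous (fun x => F (x +i* y))}.
Proof.
move=> cF; apply: (@continuous_comp _ _ _ (fun x => x +i* y) F); last exact: cF.
by apply: cvg_complex; [exact: cvg_id|exact: cvg_cst].
Qed.

Lemma continuous_vertical F (x y : R) : {for x +i* y, continuous F} ->
  {for y, continuous (fun y => F (x +i* y))}.
Proof.
move=> cF; apply: (@continuous_comp _ _ _ (fun y => x +i* y) F); last exact: cF.
by apply: cvg_complex; [exact: cvg_cst|exact: cvg_id].
Qed.

Lemma cint_cst a b (z : R[i]) : a <= b -> cint a b (fun=> z) = z * (b - a)%:C.
Proof.
move=> ab; rewrite [LHS](@cint_FTC _ a b (fun t => z * t%:C))//.
- by rewrite -mulrBr -rmorphB.
- exact: continuous_itv_cst.
- have E s : z * s%:C = Re z * s +i* (Im z * s).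
    by case: z => u v; rewrite -[LHS]/(_ +i* _) /=; congr (_ +i* _); ring.
  move=> x _; under eq_fun do rewrite E /=; under [X in _ /\ is_derive _ _ X _]eq_fun do rewrite E /=.
  by split; apply: is_derive_eq; rewrite scaler1.
Qed.

Lemma cint_real_complex a b : a <= b ->
  cint a b (fun x => x%:C) = ((b ^+ 2 - a ^+ 2) / 2)%:C.
Proof.
move=> ab; rewrite [LHS](@cint_FTC _ a b (fun t => (t ^+ 2 / 2)%:C))//.
- by rewrite -rmorphB mulrBl.
- by move=> x _; exact: continuous_real_complex.
- move=> x _ /=; split; last exact: is_derive_cst.
  apply: is_derive_eq.
  by rewrite /GRing.scale /= ; field.
Qed.

(** The contour integral of F dz, counterclockwise: bottom minus top, plus i times right minus
    left. *)
Definition rect_boundary F a b c d : R[i] :=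
  cint a b (fun x => F (x +i* c)) - cint a b (fun x => F (x +i* d)) +
  'i * (cint c d (fun y => F (b +i* y)) - cint c d (fun y => F (a +i* y))).

Definition continuous_rect F a b c d := forall x y, a <= x <= b -> c <= y <= d ->
  {for x +i* y, continuous F}.

Lemma continuous_rect_horizontal F a b c d y : continuous_rect F a b c d ->
  c <= y <= d -> continuous_itv a b (fun x => F (x +i* y)).
Proof.
move=> cF ycd x; rewrite in_itv /= => xab; apply: continuous_horizontal; exact: cF.
Qed.

Lemma continuous_rect_vertical F a b c d x : continuous_rect F a b c d ->
  a <= x <= b -> continuous_itv c d (fun y => F (x +i* y)).
Proof.
move=> cF xab y; rewrite in_itv /= => ycd; apply: continuous_vertical; exact: cF.
Qed.

Lemma rect_boundary_split F a b c d m n : continuous_rect F a b c d ->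
  a <= m <= b -> c <= n <= d ->
  rect_boundary F a b c d =
  rect_boundary F a m c n + rect_boundary F m b c n +
  rect_boundary F a m n d + rect_boundary F m b n d.
Proof.
move=> cF /andP[am mb] /andP[cn nd].
have ab := le_trans am mb; have cd := le_trans cn nd.
have H y : c <= y <= d -> cint a b (fun x => F (x +i* y)) =
    cint a m (fun x => F (x +i* y)) + cint m b (fun x => F (x +i* y)).
  move=> ycd; apply: cint_chasles => //; exact: continuous_rect_horizontal ycd.
have V x : a <= x <= b -> cint c d (fun y => F (x +i* y)) =
    cint c n (fun y => F (x +i* y)) + cint n d (fun y => F (x +i* y)).
  move=> xab; apply: cint_chasles => //; exact: continuous_rect_vertical xab.
rewrite /rect_boundary (H c) ?lexx//= (H d) ?lexx//= ?cd// (V a) ?lexx//=.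
rewrite (V b) ?lexx//= ?ab//; ring.
Qed.

(** Obtained by explicit integration, so that the first-order part of a function at a point can be
    subtracted before Cauchy's theorem is available. *)
Lemma rect_boundary_affine (u v : R[i]) a b c d : a <= b -> c <= d ->
  rect_boundary (fun z => u + v * z) a b c d = 0.
Proof.
move=> ab cd.
have H y : cint a b (fun x => u + v * (x +i* y)) =
    (u + v * ('i * y%:C)) * (b - a)%:C + v * ((b ^+ 2 - a ^+ 2) / 2)%:C.
  rewrite -(cint_cst _ ab) -(cint_real_complex ab) -cintZ; last first.
    by move=> x _; exact: continuous_real_complex.
  rewrite -cintD; first last.
  - by apply: continuous_itvZ => x _; exact: continuous_real_complex.
  - exact: continuous_itv_cst.
  by apply: eq_cint => x _; rewrite cartesianE; ring.
have V x : cint c d (fun y => u + v * (x +i* y)) =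
    (u + v * x%:C) * (d - c)%:C + (v * 'i) * ((d ^+ 2 - c ^+ 2) / 2)%:C.
  rewrite -(cint_cst _ cd) -(cint_real_complex cd) -cintZ; last first.
    by move=> y _; exact: continuous_real_complex.
  rewrite -cintD; first last.
  - by apply: continuous_itvZ => y _; exact: continuous_real_complex.
  - exact: continuous_itv_cst.
  by apply: eq_cint => y _; rewrite cartesianE; ring.
rewrite /rect_boundary !H !V !rmorphB; ring.
Qed.

Lemma rect_boundaryB F G a b c d : a <= b -> c <= d ->
  continuous_rect F a b c d -> continuous_rect G a b c d ->
  rect_boundary (fun z => F z - G z) a b c d =
  rect_boundary F a b c d - rect_boundary G a b c d.
Proof.
move=> ab cd cF cG; rewrite /rect_boundary.
have H y : c <= y <= d -> cint a b (fun x => F (x +i* y) - G (x +i* y)) =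
    cint a b (fun x => F (x +i* y)) - cint a b (fun x => G (x +i* y)).
  by move=> ycd; apply: cintB; exact: continuous_rect_horizontal ycd.
have V x : a <= x <= b -> cint c d (fun y => F (x +i* y) - G (x +i* y)) =
    cint c d (fun y => F (x +i* y)) - cint c d (fun y => G (x +i* y)).
  by move=> xab; apply: cintB; exact: continuous_rect_vertical xab.
rewrite (H c) ?lexx//= (H d) ?lexx ?cd//= (V a) ?lexx//= (V b) ?lexx ?ab//=; ring.
Qed.

Lemma normr_i : `|'i : R[i]| = 1.
Proof. by rewrite normc_def /= expr0n /= add0r expr1n sqrtr1. Qed.

(** The constant 4 is the 2 of [cint_le] times the two sides in each direction. *)
Lemma rect_boundary_le F a b c d (M : R[i]) : a <= b -> c <= d ->
  continuous_rect F a b c d ->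
  (forall x y, a <= x <= b -> c <= y <= d -> `|F (x +i* y)| <= M) ->
  `|rect_boundary F a b c d| <= 4 * M * ((b - a) + (d - c))%:C.
Proof.
move=> ab cd cF FM.
have H y : c <= y <= d -> `|cint a b (fun x => F (x +i* y))| <= 2 * M * (b - a)%:C.
  move=> ycd; apply: cint_le => //; first exact: continuous_rect_horizontal ycd.
  by move=> x; rewrite in_itv => xab; exact: FM.
have V x : a <= x <= b -> `|cint c d (fun y => F (x +i* y))| <= 2 * M * (d - c)%:C.
  move=> xab; apply: cint_le => //; first exact: continuous_rect_vertical xab.
  by move=> y; rewrite in_itv => ycd; exact: FM.
rewrite (le_trans (ler_normD _ _))// normrM normr_i mul1r.
have -> : 4 * M * (b - a + (d - c))%:C =
  (2 * M * (b - a)%:C + 2 * M * (b - a)%:C) + (2 * M * (d - c)%:C + 2 * M * (d - c)%:C).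
  by rewrite rmorphD; ring.
rewrite lerD// (le_trans (ler_normB _ _))// lerD//.
- by rewrite H ?lexx.
- by rewrite H ?lexx ?cd.
- by rewrite V ?lexx ?ab.
- by rewrite V ?lexx.
Qed.

End Goursat.

Section GoursatTheorem.
Variable R : realType.
Implicit Types (F : R[i] -> R[i]) (a b c d : R).

(** For each e > 0 the contour integral is at most e times the sum of the squared sides. This bound
    is additive under quartering, and it holds on small rectangles around any point because F is
    affine there up to a remainder that is small with respect to the distance. *)
Lemma goursat F a b c d : a <= b -> c <= d ->
  (forall x y, a <= x <= b -> c <= y <= d -> differentiable F (x +i* y)) ->
  rect_boundary F a b c d = 0.
Proof.
move=> ab cd dF.
have cF : continuous_rect F a b c d.
  by move=> x y xab ycd; apply: differentiable_continuous; exact: dF.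
have cFS a' b' c' d' : a <= a' -> b' <= b -> c <= c' -> d' <= d ->
    continuous_rect F a' b' c' d'.
  move=> aa' b'b cc' d'd x y /andP[? ?] /andP[? ?]; apply: cF.
    by rewrite (le_trans aa')//= (le_trans _ b'b).
  by rewrite (le_trans cc')//= (le_trans _ d'd).
suff B (e : R) : 0 < e -> `|rect_boundary F a b c d| <=
    (e * ((b - a) ^+ 2 + (d - c) ^+ 2))%:C.
  apply/eqP; rewrite -normr_le0.
  have [bE _] := ge0_Re (normr_ge0 (rect_boundary F a b c d)).
  rewrite bE -[0]/(0%:C) lecR; apply/ler_addgt0Pr => e e0; rewrite add0r.
  set K := (b - a) ^+ 2 + (d - c) ^+ 2 in B.
  have K0 : 0 <= K by rewrite addr_ge0 ?sqr_ge0.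
  have /B : 0 < e / (K + 1) by rewrite divr_gt0// ltr_wpDl.
  rewrite {1}bE lecR => /le_trans; apply.
  rewrite -mulrA ler_piMr ?(ltW e0)// [_^-1 * _]mulrC ler_pdivrMr ?ltr_wpDl//.
  by rewrite mul1r lerDl.
move=> e0.
apply: (@rectangle_bisection _ (fun a b c d => `|rect_boundary F a b c d| <=
    (e * ((b - a) ^+ 2 + (d - c) ^+ 2))%:C)) => //.
  move=> a' b' c' d' aa' ab' b'b cc' cd' d'd m n P1 P2 P3 P4.
  rewrite (@rect_boundary_split _ F _ _ _ _ m n); first last.
  - by rewrite /n; apply/andP; split; lra.
  - by rewrite /m; apply/andP; split; lra.
  - exact: cFS.
  have -> : (e * ((b' - a') ^+ 2 + (d' - c') ^+ 2))%:C =
    (e * ((m - a') ^+ 2 + (n - c') ^+ 2))%:C + (e * ((b' - m) ^+ 2 + (n - c') ^+ 2))%:C +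
    (e * ((m - a') ^+ 2 + (d' - n) ^+ 2))%:C + (e * ((b' - m) ^+ 2 + (d' - n) ^+ 2))%:C.
    by rewrite -!rmorphD; congr (_%:C); rewrite /m /n; field.
  do 3 (rewrite (le_trans (ler_normD _ _))// lerD//).
move=> x y xab ycd; have dFz := dF x y xab ycd.
set z := x +i* y in dFz.
pose l := 'd F z 1.
(* The 8 absorbs the 4 of [rect_boundary_le] and the 2 in (p + q)^2 <= 2 (p^2 + q^2), where p and q
   are the side lengths. *)
have e8 : 0 < (e / 8)%:C :> R[i] by rewrite ltcR divr_gt0.
have := @diff_cvg _ _ F z 1 dFz => /cvgrPdist_lt/(_ _ e8).
rewrite near_withinE => -[r' /gt0_Re[rE r0]]; rewrite rE => rP {rE}; set r := Re r' in r0 rP.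
have {}rP w : `|w - z| < r%:C -> `|F w - (F z - l * z + l * w)| <= (e / 8)%:C * `|w - z|.
  have [->|wz] := eqVneq w z; first by rewrite subrr normr0 mulr0 subrK subrr normr0.
  have wz0 : w - z != 0 by rewrite subr_eq0.
  move=> wzr; have := rP (w - z); rewrite /= sub0r normrN => /(_ wzr wz0).
  rewrite [_ *: _]mulr1 [z + _]addrC subrK -/l => /ltW.
  rewrite -(ler_pM2r (_ : 0 < `|w - z|)) ?normr_gt0// -normrM => H; apply: le_trans H.
  rewrite le_eqVlt; apply/orP; left; apply/eqP; rewrite -normrN; congr (`|_|).
  by rewrite mulrBl mulrAC mulVf// mul1r; ring.
have r20 : 0 < r / 2 by rewrite divr_gt0//; move: r0; rewrite ltcR.
(* Points of the rectangle are at distance at most the sum of its sides from z, so sides below r / 2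
   keep it within radius r. *)
exists (r / 2) => // a' b' c' d' aa' /andP[ax xb] b'b cc' /andP[cy yd] d'd wr hr.
have ab' := le_trans ax xb; have cd' := le_trans cy yd.
have cF' : continuous_rect F a' b' c' d' by exact: cFS.
have cA : continuous_rect (fun w => (F z - l * z) + l * w) a' b' c' d'.
  move=> x' y' _ _; apply: continuousD; first exact: cst_continuous.
  by apply: continuousM; [exact: cst_continuous | exact: cvg_id].
rewrite -[rect_boundary _ _ _ _ _]subr0.
rewrite -(rect_boundary_affine (F z - l * z) l ab' cd') -(rect_boundaryB ab' cd' cF' cA).
pose w := (b' - a') + (d' - c').
have w0 : 0 <= w by rewrite /w; lra.
have cFA : continuous_rect (fun w => F w - ((F z - l * z) + l * w)) a' b' c' d'.
  by move=> x' y' xab' ycd'; apply: continuousB; [exact: cF' | exact: cA].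
apply: le_trans (rect_boundary_le (M := (e / 8 * w)%:C) ab' cd' cFA _) _.
- move=> x' y' /andP[ax' xb'] /andP[cy' yd'].
  have zE : `|x' +i* y' - z| <= w%:C.
    apply: le_trans (normr_le_ReIm _) _; rewrite lecR /z -[_ - _]/(_ +i* _) /= /w.
    by apply: lerD; rewrite ler_distl; apply/andP; split; lra.
  rewrite (le_trans (rP _ _))//.
    by rewrite (le_lt_trans zE)// ltcR /w; lra.
  by rewrite [(e / 8 * w)%:C]rmorphM ler_pM2l.
- rewrite -[4]/(4%:R) -(rmorph_nat (real_complex R)) -!rmorphM lecR -/w.
  suff : e * (w ^+ 2 / 2) <= e * ((b' - a') ^+ 2 + (d' - c') ^+ 2).
    by apply: le_trans; rewrite le_eqVlt; apply/orP; left; apply/eqP; field.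
  rewrite ler_pM2l// /w -subr_ge0.
  set p := b' - a'; set q := d' - c'.
  have -> : p ^+ 2 + q ^+ 2 - (p + q) ^+ 2 / 2 = (p - q) ^+ 2 / 2 by field.
  by rewrite divr_ge0// sqr_ge0.
Qed.

End GoursatTheorem.

(** * Derivatives as means over circles *)

Section ComplexExp.
Variable R : realType.
Implicit Types (u v : R[i]) (x y : R).

Definition cis y : R[i] := cos y +i* sin y.
Definition cexp u : R[i] := (expR (Re u))%:C * cis (Im u).

Lemma cisD x y : cis (x + y) = cis x * cis y.
Proof. by rewrite /cis cosD sinD -[RHS]/(_ +i* _) /= [sin x * _ + _]addrC. Qed.

Lemma normr_cis y : `|cis y| = 1.
Proof. by rewrite normc_def /= cos2Dsin2 sqrtr1. Qed.

Lemma cis_neq0 y : cis y != 0.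
Proof. by rewrite -normr_eq0 normr_cis oner_eq0. Qed.

Lemma cis0 : cis 0 = 1.
Proof. by rewrite /cis cos0 sin0. Qed.

Lemma cis2pi : cis (2 * pi) = 1.
Proof. by rewrite /cis mulr_natl cos2pi sin2pi. Qed.

Lemma cexpD u v : cexp (u + v) = cexp u * cexp v.
Proof. by rewrite /cexp ReD ImD cisD expRD rmorphM mulrACA. Qed.

Lemma normr_cexp u : `|cexp u| = (expR (Re u))%:C.
Proof. by rewrite normrM normr_cis mulr1 normr_real_complex ger0_norm// expR_ge0. Qed.

Lemma cexp_neq0 u : cexp u != 0.
Proof. by rewrite -normr_eq0 normr_cexp -[0]/(0%:C) (inj_eq (@complexI R)) gt_eqF// expR_gt0. Qed.

Lemma is_derive_little (f : R -> R) (l e : R) : is_derive (0 : R) (1 : R) f l -> 0 < e ->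
  \forall x \near 0, `|f x - f 0 - l * x| <= e * `|x|.
Proof.
move=> df e0.
have /cvgrPdist_lt/(_ _ e0) : h^-1 *: (f (h *: 1 + 0) - f 0) @[h --> 0^'] --> l.
  by have [dr <-] := df; exact: dr.
rewrite near_withinE; apply: filterS => h.
have [-> _|h0 /(_ isT)] := eqVneq h 0; first by rewrite subrr mulr0 subrr !normr0 mulr0.
rewrite [h *: 1]mulr1 addr0 => /ltW; rewrite -(ler_pM2r (_ : 0 < `|h|)) ?normr_gt0//.
rewrite -normrM mulrBl [_ *: _ * _]mulrAC mulVf// mul1r => H; apply: le_trans H.
by rewrite distrC.
Qed.

(** Differentiability of [cexp] at 0 is drawn from the three real derivatives; the addition formula
    then carries it to every point. *)
Lemma cexp_little (e : R) : 0 < e ->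
  \forall h \near (0 : R[i]), `|cexp h - 1 - h| <= e%:C * `|h|.
Proof.
move=> e0.
have e8 : 0 < e / 8 by rewrite divr_gt0.
have /(is_derive_little)/(_ e8) d1 := @is_derive_expR R 0.
have /(is_derive_little)/(_ e8) d2 := @is_derive_cos R 0.
have /(is_derive_little)/(_ e8) d3 := @is_derive_sin R 0.
have d4 : \forall x \near (0 : R), `|x| <= e / 8 /\ `|x| <= 1.
  apply/nbhs_ballP; exists (Num.min (e / 8) 1); first by rewrite /= lt_min e8 ltr01.
  by move=> x; rewrite /ball /= sub0r normrN lt_min => /andP[/ltW ? /ltW].
have [r r0 rP] : exists2 r, 0 < r & forall x, `|x| < r ->
  [/\ `|expR x - 1 - x| <= e / 8 * `|x|, `|cos x - 1| <= e / 8 * `|x|,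
      `|sin x - x| <= e / 8 * `|x| & `|x| <= e / 8 /\ `|x| <= 1].
  have [r r0 rP] := (nbhs_ballP _ _).1 (filterI (filterI d1 d2) (filterI d3 d4)).
  exists r => // x xr; have [|[H1 H2] [H3 H4]] := rP x.
    by rewrite /ball /= sub0r normrN.
  by move: H1 H2 H3; rewrite expR0 cos0 sin0 oppr0 mul0r !(subr0, addr0) mul1r; split.
apply/nbhs_ballP; exists r%:C; first by rewrite /= ltcR.
move=> [x y]; rewrite /ball /= sub0r normrN => hr.
have xh : `|x|%:C <= `|x +i* y| by exact: (normr_Re_le (x +i* y)).
have yh : `|y|%:C <= `|x +i* y| by exact: (normr_Im_le (x +i* y)).
have xr : `|x| < r by rewrite -ltcR (le_lt_trans xh).
have yr : `|y| < r by rewrite -ltcR (le_lt_trans yh).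
have [hE h0] := ge0_Re (normr_ge0 (x +i* y)).
move: xh yh; rewrite hE; set H := Re _ in h0 *; rewrite !lecR => xh yh.
have [X1 _ _ [X2 X3]] := rP _ xr.
have [_ Y1 Y2 _] := rP _ yr.
(* Each of the first two terms isolates first-order remainders of exp, cos and sin, and the last one
   is the second-order term i x y. With |1 + x| <= 2 they cost 1, 4 and 1 eighths of e. *)
have -> : cexp (x +i* y) - 1 - (x +i* y) =
  (expR x - 1 - x)%:C * cis y + (1 + x)%:C * ((cos y - 1) +i* (sin y - y)) + x%:C * (y *i).
  rewrite /cexp /cis /=.
  rewrite -[LHS]/(_ +i* _) -[RHS]/(_ +i* _) /=; congr (_ +i* _); ring.
have B1 : `|(expR x - 1 - x)%:C * cis y| <= (e / 8 * H)%:C.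
  rewrite normrM normr_cis mulr1 normr_real_complex lecR (le_trans X1)// ler_pM2l//.
have B2 : `|(1 + x)%:C * ((cos y - 1) +i* (sin y - y))| <= (2 * (e / 8 * H + e / 8 * H))%:C.
  rewrite normrM normr_real_complex rmorphM ler_pM//.
    by rewrite ler0c.
    by rewrite lecR (le_trans (ler_normD _ _))// normr1; lra.
  rewrite (le_trans (normr_le_ReIm _))// lecR /= lerD// ?(le_trans Y1)// ?(le_trans Y2)// ler_pM2l//.
have B3 : `|x%:C * (y *i)| <= (e / 8 * H)%:C.
  rewrite normrM normr_real_complex (_ : `|y *i| = `|y|%:C); last first.
    by rewrite normc_def /= expr0n /= add0r sqrtr_sqr.
  by rewrite -rmorphM lecR ler_pM.
rewrite (le_trans (ler_normD _ _))// (le_trans (lerD (ler_normD _ _) (lexx _)))//.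
rewrite (le_trans (lerD (lerD B1 B2) B3))// -!rmorphD -rmorphM lecR.
have : 0 <= e * H by rewrite mulr_ge0// ltW.
lra.
Qed.

Lemma differentiable_cexp u : differentiable cexp u.
Proof.
apply/derivable1_diffP/cvg_ex; exists (cexp u).
apply/cvgrPdist_le => e' /gt0_Re[-> e0]; set e := Re e' in e0 *.
have k0 : 0 < e / expR (Re u) by rewrite divr_gt0// expR_gt0.
rewrite near_withinE; have := cexp_little k0; apply: filterS => h hP hn0.
rewrite -(ler_pM2r (_ : 0 < `|h|)) ?normr_gt0// -normrM mulrBl /=.
rewrite [h *: 1]mulr1 cexpD [_ *: _]mulrC mulfVK//.
rewrite -normrN (_ : - _ = cexp u * (cexp h - 1 - h)); last by ring.
rewrite normrM normr_cexp (le_trans (ler_wpM2l _ hP)) ?ler0c ?expR_ge0//.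
by rewrite mulrA -rmorphM [expR _ * _]mulrC divfK// gt_eqF// expR_gt0.
Qed.

End ComplexExp.

Section CauchyFormula.
Variable R : realType.
Implicit Types (g : R[i] -> R[i]) (x y : R).

Lemma eq0_norm_le (z : R[i]) (K : R) : 0 <= K ->
  (forall e : R, 0 < e -> `|z| <= (K * e)%:C) -> z = 0.
Proof.
move=> K0 zK; apply/eqP; rewrite -normr_le0.
have [zE _] := ge0_Re (normr_ge0 z); rewrite zE -[0]/(0%:C) lecR.
apply/ler_addgt0Pr => e e0; rewrite add0r.
have /zK : 0 < e / (K + 1) by rewrite divr_gt0// ltr_wpDl.
rewrite zE lecR => /le_trans; apply.
by rewrite mulrCA ler_piMr ?(ltW e0)// ler_pdivrMr ?ltr_wpDl// mul1r lerDl.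
Qed.

Lemma continuous_cis : continuous (@cis R).
Proof.
by move=> y; apply: cvg_complex; [exact: continuous_cos|exact: continuous_sin].
Qed.

(* Pulled back by the exponential, [(g z - g 0) / z] is holomorphic and
   [2 pi i]-periodic on a left half-plane: the horizontal sides of the rectangle
   [[a, 0] * [0, 2 pi]] cancel, and the left side tends to ['d g 0 1]. *)
Lemma circle_derivative g : (forall z, `|z| <= 1 -> differentiable g z) ->
  cint 0 (2 * pi) (fun y => (g (cis y) - g 0) / cis y) = (2 * pi)%:C * 'd g 0 1.
Proof.
move=> dg; pose F u := (g (cexp u) - g 0) / cexp u.
have pi20 : 0 <= 2 * pi :> R by rewrite mulr_ge0// pi_ge0.
have dF u : Re u <= 0 -> differentiable F u.
  move=> u0; have du := @differentiable_cexp R u.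
  apply: differentiableM; last by apply: differentiableV => //; exact: cexp_neq0.
  apply: differentiableB; last exact: differentiable_cst.
  apply: (@differentiable_comp _ _ _ _ (@cexp R) g); first exact: du.
  by apply: dg; rewrite normr_cexp lecR -expR0 ler_expR.
have cF a : a <= 0 -> continuous_itv 0 (2 * pi) (fun y => F (a +i* y)).
  by move=> a0 y _; apply/continuous_vertical/differentiable_continuous/dF.
have per x : F (x +i* 0) = F (x +i* (2 * pi)).
  by rewrite /F /cexp /= cis2pi cis0.
have EF a : a <= 0 -> cint 0 (2 * pi) (fun y => F (0 +i* y)) =
    cint 0 (2 * pi) (fun y => F (a +i* y)).
  move=> a0; have := goursat a0 pi20 (F := F).
  rewrite /rect_boundary (eq_cint (fun x _ => per x)) subrr add0r.
  move=> H; apply/eqP; rewrite -subr_eq0.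
  suff /eqP : 'i * (cint 0 (2 * pi) (fun y => F (0 +i* y)) -
     cint 0 (2 * pi) (fun y => F (a +i* y))) = 0.
    by rewrite mulf_eq0 -normr_eq0 normr_i oner_eq0.
  by apply: H => x y /andP[_ x0] _; apply: dF.
transitivity (cint 0 (2 * pi) (fun y => F (0 +i* y))).
  by apply: eq_cint => y _; rewrite /F /cexp /= expR0 mul1r.
apply/eqP; rewrite -subr_eq0; apply/eqP.
apply: (@eq0_norm_le _ (4 * pi)) => [|e e0]; first by rewrite mulr_ge0// pi_ge0.
have e0C : 0 < e%:C :> R[i] by rewrite ltcR.
have dg0 : differentiable g 0 by apply: dg; rewrite normr0 ler01.
have := @diff_cvg _ _ g 0 1 dg0 => /cvgrPdist_le/(_ _ e0C).
rewrite near_withinE => /nbhs_ballP[r' /gt0_Re[-> r0]] rP.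
set r := Re r' in r0 rP.
(* So far to the left that the circle traced by [cexp] has radius [expR a < r], where the difference
   quotient is within e of the derivative. *)
pose a := Num.min 0 (ln (r / 2)).
have a0 : a <= 0 by rewrite ge_min lexx.
have ar : expR a < r.
  rewrite (@le_lt_trans _ _ (r / 2))//; last by rewrite ltr_pdivrMr// ltr_pMr// ltr1n.
  by rewrite -[leRHS]lnK ?posrE ?divr_gt0// ler_expR ge_min lexx orbT.
have -> : (2 * pi)%:C * 'd g 0 1 = cint 0 (2 * pi) (fun=> 'd g 0 1).
  by rewrite cint_cst// subr0 mulrC.
rewrite (EF a a0) -cintB; [|exact: cF|exact: continuous_itv_cst].
apply: le_trans (cint_le (M := e%:C) pi20 _ _) _.
- by apply: continuous_itvD; [exact: cF|exact: continuous_itv_cst].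
- move=> y _; set w := cexp (a +i* y).
  have w0 : w != 0 by exact: cexp_neq0.
  rewrite distrC.
  have := rP w _ w0; rewrite /ball /= sub0r normrN normr_cexp ltcR => /(_ ar).
  by rewrite add0r [_ *: _]mulr1 [_^-1 * _]mulrC.
- by rewrite subr0 -[2 * _]/(2%:R * _) -(rmorph_nat (real_complex R)) -!rmorphM lecR; nra.
Qed.

(** Apply [circle_derivative] to z g z: its quotient by z is g, and its derivative at 0 is g 0. *)
Lemma circle_mean g : (forall z, `|z| <= 1 -> differentiable g z) ->
  cint 0 (2 * pi) (fun y => g (cis y)) = (2 * pi)%:C * g 0.
Proof.
move=> dg; pose q z := z * g z.
have dq z : `|z| <= 1 -> differentiable q z.
  by move=> z1; apply: differentiableM => //; exact: dg.
have := circle_derivative dq; rewrite /q mul0r.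
under eq_cint do rewrite subr0 mulrAC divff ?cis_neq0// mul1r.
move=> ->; congr (_ * _).
have dg0 : differentiable g 0 by apply: dg; rewrite normr0 ler01.
apply: diff_cvg_unique.
  by apply: dq; rewrite normr0 ler01.
have /differentiable_continuous := dg0; rewrite /continuous_at => cg.
apply: (cvg_trans (G := g h @[h --> 0^'])); last first.
  by apply: cvg_trans cg; apply: cvg_app; exact: cvg_within.
apply: near_eq_cvg; near=> h; have h0 : h != 0 by near: h; exact: nbhs_dnbhs_neq.
by rewrite add0r [_ *: _]mulr1 /q mul0r subr0 mulKf.
Unshelve. all: by end_near. Qed.

End CauchyFormula.

(** * Cauchy estimates *)

Section Slices.
Variable R : realType.
Variable V : normedModType R[i].
Implicit Types (f : V -> R[i]) (x v : V) (r M : R[i]).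

Lemma differentiable_line x v (z : R[i]) : differentiable (fun z : R[i] => x + z *: v) z.
Proof. by apply: differentiableD => //; exact: differentiableZl. Qed.

Lemma diff_line f x v : differentiable f x -> 'd (fun z : R[i] => f (x + z *: v)) 0 1 = 'd f x v.
Proof.
move=> df; apply: diff_cvg_unique.
  apply: (@differentiable_comp _ _ _ _ (fun z : R[i] => x + z *: v) f).
    exact: differentiable_line.
  by rewrite scale0r addr0.
have := diff_cvg (v := v) df; apply: cvg_trans; apply: near_eq_cvg; near=> h.
by rewrite add0r scale0r addr0 [h *: 1]mulr1.
Unshelve. all: by end_near. Qed.

(** The one-variable formula on the complex line through x directed by v. Since nothing else is
    needed of the space, all the estimates that follow hold in an arbitrary normed space, in
    particular on the product used for implicit functions. *)
Lemma diff_circle f x v : (forall z : R[i], `|z| <= 1 -> differentiable f (x + z *: v)) ->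
  cint 0 (2 * pi) (fun y => (f (x + cis y *: v) - f x) / cis y) = (2 * pi)%:C * 'd f x v.
Proof.
move=> df; rewrite -(@diff_line f); last first.
  by have := df 0; rewrite normr0 scale0r addr0; apply; exact: ler01.
rewrite -circle_derivative; last first.
  move=> z z1; apply: (@differentiable_comp _ _ _ _ (fun z : R[i] => x + z *: v) f).
    exact: differentiable_line.
  exact: df.
by apply: eq_cint => y _; rewrite scale0r addr0.
Qed.

Lemma twopi_gt0 : 0 < (2 * pi)%:C :> R[i].
Proof. by rewrite ltcR mulr_gt0// pi_gt0. Qed.

Lemma continuous_circle f x v (y : R) : (forall z : R[i], `|z| <= 1 -> differentiable f (x + z *: v)) ->
  {for y, continuous (fun y => (f (x + cis y *: v) - f x) / cis y)}.
Proof.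
move=> df; have ccis := @continuous_cis R y.
apply: continuousM; last by apply: continuousV; [exact: cis_neq0 | exact: ccis].
apply: continuousB; last exact: cst_continuous.
apply: (@continuous_comp _ _ _ (fun y => x + cis y *: v) f).
  apply: continuousD; first exact: cst_continuous.
  by apply: cvgZr_tmp; exact: ccis.
by apply/differentiable_continuous/df; rewrite normr_cis.
Qed.

Lemma diff_le_sup f x v M : (forall z : R[i], `|z| <= 1 -> differentiable f (x + z *: v)) ->
  (forall z : R[i], `|z| <= 1 -> `|f (x + z *: v) - f x| <= M) ->
  `|'d f x v| <= 2 * M.
Proof.
move=> df fM; have p0 := twopi_gt0.
rewrite -(ler_pM2l p0) -[X in X * `|_|](gtr0_norm p0) -normrM -diff_circle//.
have pi0 : 0 <= 2 * pi :> R by rewrite mulr_ge0// pi_ge0.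
have := @cint_le _ 0 (2 * pi) (fun y => (f (x + cis y *: v) - f x) / cis y) M pi0.
rewrite subr0 [(2 * pi)%:C * _]mulrC; apply.
  by move=> y _; exact: continuous_circle.
by move=> y _; rewrite normrM normfV normr_cis invr1 mulr1 fM// normr_cis.
Qed.

(** The real mean value theorem is applied to the real and imaginary parts of the restriction to the
    segment, whence the 2. The constant [l] stands for an approximate value of the differential. *)
Lemma mean_value_le f p v (l : R[i]) (K : R[i]) :
  (forall t : R, 0 <= t <= 1 -> differentiable f (p + t%:C *: v)) ->
  (forall t : R, 0 <= t <= 1 -> `|'d f (p + t%:C *: v) v - l| <= K) ->
  `|f (p + v) - f p - l| <= 2 * K.
Proof.
move=> df dK.
have K0 : 0 <= K by apply: le_trans (dK 0 _); rewrite ?lexx ?ler01.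
have [KE _] := ge0_Re K0.
have key (P : R[i] -> R) (PD : forall z w : R[i], P (z - w) = P z - P w)
    (Pn : forall z, `|P z|%:C <= `|z|)
    (dP : forall t : R, 0 <= t <= 1 -> is_derive t 1 (fun s : R => P (f (p + s%:C *: v)))
       (P ('d f (p + t%:C *: v) v))) : `|P (f (p + v) - f p - l)|%:C <= K.
  pose h (s : R) := P (f (p + s%:C *: v)) - s * P l.
  have dh (t : R) : 0 <= t <= 1 -> is_derive t 1 h (P ('d f (p + t%:C *: v) v - l)).
    move=> /dP t1; rewrite PD; apply: is_deriveB.
    by apply: is_derive_eq; rewrite scaler0 add0r [_ *: _]mulr1.
  have [||c c01] := @MVT_segment _ h (fun t => P ('d f (p + t%:C *: v) v - l)) 0 1 ler01.
  - by move=> t /subset_itv_oo_cc; rewrite /= in_itv; exact: dh.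
  - apply: continuous_in_subspaceT => t /set_mem /=; rewrite in_itv => /dh dt.
    by apply: differentiable_continuous; exact/derivable1_diffP.
  rewrite subr0 mulr1 /h scale1r scale0r addr0 mul1r mul0r subr0 => E.
  rewrite 2!PD addrAC E; apply: le_trans (Pn _) _; apply: dK.
  by move: c01; rewrite in_itv.
rewrite (le_trans (normr_le_ReIm _))// rmorphD mulr_natl mulr2n lerD//.
  apply: key; [exact: ReB|exact: normr_Re_le|].
  by move=> t /df dt; exact: is_derive_Re_line.
apply: key; [exact: ImB|exact: normr_Im_le|].
by move=> t /df dt; exact: is_derive_Im_line.
Qed.

(** Holomorphy together with a bound is all that Cauchy estimates consume. Norms take their values
    in [R[i]], so [r] and [M] live there too; a comparison with a norm forces them to be real. *)
Definition holo_ball f x0 r M := forall x, `|x - x0| < r ->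
  differentiable f x /\ `|f x| <= M.

Lemma holo_ballS f x0 r M x1 r1 : holo_ball f x0 r M -> `|x1 - x0| + r1 <= r ->
  holo_ball f x1 r1 M.
Proof.
move=> fr r1r x xr; apply: fr; apply: lt_le_trans r1r.
by rewrite -(subrKA x1) addrC (le_lt_trans (ler_normD _ _))// ltrD2l.
Qed.

Lemma diff_scale f x (c : R[i]) v : 'd f x (c *: v) = c * 'd f x v.
Proof. exact: linearZ. Qed.

Lemma holo_ball_ge0 f x0 r M : 0 < r -> holo_ball f x0 r M -> 0 <= M.
Proof.
move=> r0 /(_ x0); rewrite subrr normr0 => /(_ r0)[_].
exact: le_trans.
Qed.

Lemma diff_le_scale f x v r K : 0 < r -> 0 <= K ->
  (forall w, `|w| = r -> `|'d f x w| <= K) -> `|'d f x v| <= K / r * `|v|.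
Proof.
move=> r0 K0 fK; have [->|v0] := eqVneq v 0; first by rewrite linear0 !normr0 mulr0.
have nv0 : 0 < `|v| by rewrite normr_gt0.
have c0 : 0 < r / `|v| by rewrite divr_gt0.
have := fK ((r / `|v|) *: v); rewrite normrZ (gtr0_norm c0) divfK ?gt_eqF// => /(_ erefl).
rewrite diff_scale normrM (gtr0_norm c0) -ler_pdivlMl// invf_div => H.
by rewrite (_ : K / r * `|v| = `|v| / r * K)//; ring.
Qed.

(** Vectors of length r / 2 keep the unit disc of their line inside the ball, where f oscillates by
    at most 2M; [diff_le_sup] doubles this, and rescaling divides it by r / 2. *)
Lemma cauchy_estimate f x0 r M v : 0 < r -> holo_ball f x0 r M ->
  `|'d f x0 v| <= 8 * M / r * `|v|.
Proof.
move=> r0 fr; have M0 := holo_ball_ge0 r0 fr.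
have r20 : 0 < r / 2 by rewrite divr_gt0.
have -> : 8 * M / r = (2 * (M + M)) / (r / 2) by field; rewrite gt_eqF.
apply: diff_le_scale => // [|w wr]; first by rewrite mulr_ge0// addr_ge0.
have wz (z : R[i]) : `|z| <= 1 -> `|x0 + z *: w - x0| < r.
  move=> z1; rewrite addrC addKr normrZ wr (@le_lt_trans _ _ (r / 2))//.
    by rewrite ler_piMl// ltW.
  by rewrite ltr_pdivrMr// ltr_pMr// ltr1n.
apply: diff_le_sup => z z1; first by have [] := fr _ (wz z z1).
rewrite (le_trans (ler_normB _ _))// lerD//; first by have [] := fr _ (wz z z1).
by have [] := fr x0; rewrite ?subrr ?normr0.
Qed.

(** On the half ball, Cauchy's estimate with radius r / 2 bounds the differential by 16 M / r; the
    mean value inequality doubles it. *)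
Lemma holo_lipschitz f x0 r M x y : 0 < r -> holo_ball f x0 r M ->
  `|x - x0| <= r / 2 -> `|y - x0| <= r / 2 -> `|f x - f y| <= 32 * M / r * `|x - y|.
Proof.
move=> r0 fr xr yr; have M0 := holo_ball_ge0 r0 fr.
have r20 : 0 < r / 2 by rewrite divr_gt0.
have tr (t : R) : 0 <= t <= 1 -> `|y + t%:C *: (x - y) - x0| <= r / 2.
  move=> /andP[t0 t1].
  have -> : y + t%:C *: (x - y) - x0 = t%:C *: (x - x0) + (1 - t)%:C *: (y - x0).
    have -> : x - y = (x - x0) - (y - x0) by rewrite opprB addrA subrK.
    by rewrite addrAC scalerBr rmorphB scalerBl scale1r addrCA.
  rewrite (le_trans (ler_normD _ _))// !normrZ !normr_real_complex.
  rewrite !ger0_norm ?subr_ge0//.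
  have -> : r / 2 = t%:C * (r / 2) + (1 - t)%:C * (r / 2) by rewrite rmorphB; ring.
  by rewrite lerD// ler_wpM2l// ler0c// subr_ge0.
have -> : 32 * M / r * `|x - y| = 2 * ((16 * M / r) * `|x - y|) by field; rewrite gt_eqF.
have -> : f x - f y = f (y + (x - y)) - f y - 0 by rewrite [y + _]addrC subrK subr0.
apply: mean_value_le => t /tr tt.
  have [] // := fr _ (le_lt_trans tt _).
  by rewrite ltr_pdivrMr// ltr_pMr// ltr1n.
rewrite subr0.
have -> : 16 * M / r = 8 * M / (r / 2) by field; rewrite gt_eqF.
apply: cauchy_estimate => //; apply: holo_ballS fr _.
by rewrite [leRHS]splitr lerD2r.
Qed.

Lemma differentiable_shift f (a x : V) : differentiable f (x + a) ->
  differentiable (fun y : V => f (y + a)) x.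
Proof.
by move=> df; apply: (@differentiable_comp _ _ _ _ (fun y => y + a) f).
Qed.

Lemma diffB_apply f g x v : differentiable f x -> differentiable g x ->
  'd (fun y => f y - g y : R[i]) x v = 'd f x v - 'd g x v.
Proof.
move=> df dg; apply: diff_cvg_unique; first exact: differentiableB.
apply: cvg_trans (cvgB (diff_cvg (v := v) df) (diff_cvg (v := v) dg)).
by apply: near_eq_cvg; near=> h; rewrite !fctE; ring.
Unshelve. all: by end_near. Qed.

Lemma diff_shift f (a x v : V) : differentiable f (x + a) ->
  'd (fun y : V => f (y + a)) x v = 'd f (x + a) v.
Proof.
move=> df; apply: diff_cvg_unique; first exact: differentiable_shift.
have := diff_cvg (v := v) df; apply: cvg_trans; apply: near_eq_cvg; near=> h.
by rewrite addrAC.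
Unshelve. all: by end_near. Qed.

End Slices.

Section SecondOrder.
Variable R : realType.
Variable V : normedModType R[i].
Implicit Types (f : V -> R[i]) (x v : V) (r M : R[i]).

(* Cauchy estimate for [z |-> f (z + (x - x0)) - f z], which is small. *)
Lemma diff_lipschitz f x0 r M x v : 0 < r -> holo_ball f x0 r M ->
  `|x - x0| <= r / 4 ->
  `|'d f x v - 'd f x0 v| <= 8 * 32 * 4 * M / r ^+ 2 * `|x - x0| * `|v|.
Proof.
move=> r0 fr xr; have M0 := holo_ball_ge0 r0 fr.
pose a := x - x0; pose g (z : V) : R[i] := f (z + a) - f z.
have r4r : r / 4 < r by rewrite ltr_pdivrMr// ltr_pMr// ltr1n.
have r40 : 0 < r / 4 by rewrite divr_gt0.
have ar z : `|z - x0| <= r / 4 -> `|z + a - x0| <= r / 2.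
  move=> zr; rewrite addrAC (le_trans (ler_normD _ _))//.
  have -> : r / 2 = r / 4 + r / 4 by field.
  exact: lerD.
have r2r : r / 2 < r by rewrite ltr_pdivrMr// ltr_pMr// ltr1n.
have df z : `|z - x0| <= r / 4 -> differentiable f z /\ differentiable f (z + a).
  by move=> zr; have [] := fr _ (le_lt_trans zr r4r);
   have [] := fr _ (le_lt_trans (ar _ zr) r2r).
have dg z : `|z - x0| <= r / 4 -> differentiable g z.
  by move=> /df[d1 d2]; apply: differentiableB; [exact: differentiable_shift | exact: d1].
have gr : holo_ball g x0 (r / 4) (32 * M / r * `|a|).
  move=> z /ltW zr; split; first exact: dg.
  have <- : `|z + a - z| = `|a| by rewrite addrAC subrr add0r.
  apply: holo_lipschitz fr _ _ => //; first exact: ar.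
  by rewrite (le_trans zr)// ler_pM2l// lef_pV2 ?posrE// ler_nat.
have -> : 'd f x v - 'd f x0 v = 'd g x0 v.
  have xx : `|x0 - x0| <= r / 4 by rewrite subrr normr0 ltW.
  have [d1 d2] := df _ xx; have d3 := differentiable_shift d2.
  have E := diff_shift v d2.
  have ax : x0 + a = x by rewrite addrC subrK.
  rewrite ax in E.
  have E2 := diffB_apply v d3 d1.
  by apply: etrans (esym E2); rewrite -E.
have -> : 8 * 32 * 4 * M / r ^+ 2 * `|x - x0| * `|v| = 8 * (32 * M / r * `|a|) / (r / 4) * `|v|.
  by rewrite /a; field; rewrite gt_eqF.
exact: cauchy_estimate gr.
Qed.

(** The mean value inequality with [l := 'd f x0 v]. The remainder depends on f only through r and
    M, so it is uniform over families of functions sharing a ball and a bound. *)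
Lemma holo_second_order f x0 r M v : 0 < r -> holo_ball f x0 r M ->
  `|v| <= r / 4 -> `|f (x0 + v) - f x0 - 'd f x0 v| <= 2 * (8 * 32 * 4) * M / r ^+ 2 * `|v| ^+ 2.
Proof.
move=> r0 fr vr; have M0 := holo_ball_ge0 r0 fr.
have r4r : r / 4 < r by rewrite ltr_pdivrMr// ltr_pMr// ltr1n.
have tv (t : R) : 0 <= t <= 1 -> `|x0 + t%:C *: v - x0| <= `|v|.
  move=> /andP[t0 t1]; rewrite addrC addKr normrZ normr_real_complex ger0_norm//.
  by rewrite ler_piMl// lecR.
have -> : 2 * (8 * 32 * 4) * M / r ^+ 2 * `|v| ^+ 2 = 2 * (8 * 32 * 4 * M / r ^+ 2 * `|v| * `|v|).
  by field; rewrite gt_eqF.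
apply: mean_value_le => t /tv tt.
  by have [] := fr _ (le_lt_trans (le_trans tt vr) r4r).
rewrite (le_trans (diff_lipschitz v r0 fr (le_trans tt vr)))//.
rewrite ler_wpM2r// ler_wpM2l//.
by rewrite divr_ge0 ?mulr_ge0 ?exprn_ge0// ltW.
Qed.

End SecondOrder.

(** * Integrals depending holomorphically on a parameter *)

Section HolomorphicIntegral.
Variable R : realType.
Variable V : normedModType R[i].
Implicit Types (f : V -> R[i]) (x v : V) (r M K : R[i]).

(** An epsilon form of differentiability: the bound by [K] supplies the continuity of the candidate
    [L], and uniqueness of the differential identifies it. *)
Lemma differentiable_littleo f (L : V -> R[i]) x K : 0 <= K ->
  (forall c u v, L (c *: u + v) = c * L u + L v) ->
  (forall v, `|L v| <= K * `|v|) ->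
  (forall e : R[i], 0 < e -> \forall v \near 0, `|f (x + v) - f x - L v| <= e * `|v|) ->
  differentiable f x /\ forall v, 'd f x v = L v.
Proof.
move=> K0 linL LK fL.
pose L' : {linear V -> R[i]} := HB.pack L (GRing.isLinear.Build R[i] V R[i] *:%R L linL).
have cL : continuous L'.
  move=> y; apply/cvgrPdist_lt => e e0.
  have K1 : 0 < K + 1 by rewrite ltr_wpDl.
  apply/nbhs_ballP; exists (e / (K + 1)) => /=; first by rewrite divr_gt0.
  move=> z; rewrite -ball_normE /= ltr_pdivlMr// => yz.
  have <- : L' (y - z) = L' y - L' z by exact: linearB.
  rewrite (le_lt_trans _ yz)// (le_trans (LK _))// mulrC ler_wpM2l//.
  by rewrite lerDl.
have fLo : f \o shift x = cst (f x) + L' +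
    landau.the_littleo landau.the_tag (nbhs_filter_on 0)
    (Phantom (set_system V) (nbhs 0)) (f \o shift x \- (cst (f x) + L')) id.
  apply/landau.eqaddoP => e /fL; apply: filterS => v H; apply: le_trans H.
  by rewrite !fctE /= opprD addrA [v + x]addrC.
have dE := diff_unique cL fLo.
split; last by move=> v; rewrite dE.
by apply/diff_locallyP; rewrite dE.
Qed.


Lemma differentiable_quadratic f (L : V -> R[i]) x r K K' : 0 < r -> 0 <= K -> 0 <= K' ->
  (forall c u v, L (c *: u + v) = c * L u + L v) ->
  (forall v, `|L v| <= K * `|v|) ->
  (forall v, `|v| < r -> `|f (x + v) - f x - L v| <= K' * `|v| ^+ 2) ->
  differentiable f x /\ forall v, 'd f x v = L v.
Proof.
move=> r0 K0 K'0 linL LK fL; apply: (differentiable_littleo K0 linL LK) => e e0.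
have K1 : 0 < K' + 1 by rewrite ltr_wpDl.
have d0 : 0 < e / (K' + 1) by rewrite divr_gt0.
have H1 : \forall v \near (0 : V), `|v| < r.
  by apply/nbhs_ballP; exists r => //= v; rewrite -ball_normE /= sub0r normrN.
have H2 : \forall v \near (0 : V), `|v| < e / (K' + 1).
  by apply/nbhs_ballP; exists (e / (K' + 1)) => //= v; rewrite -ball_normE /= sub0r normrN.
apply: filterS2 H1 H2 => v /fL H; rewrite ltr_pdivlMr// => ve.
apply: (le_trans H); rewrite expr2 mulrA ler_wpM2r// mulrC.
by apply: le_trans (ltW ve); rewrite ler_wpM2l// lerDl.
Qed.

Lemma ltr_dist3 (x y u w e : R[i]) : `|x - u| <= e / 3 -> `|u - w| < e / 3 ->
  `|y - w| <= e / 3 -> `|x - y| < e.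
Proof.
move=> xu uw yw; rewrite (_ : x - y = (x - u) + (u - w) - (y - w)); last by ring.
rewrite (_ : e = e / 3 + e / 3 + e / 3); last by field.
rewrite (le_lt_trans (ler_normB _ _))// ltr_leD//.
by rewrite (le_lt_trans (ler_normD _ _))// ler_ltD.
Qed.

(** Differentiation under the integral sign. The quadratic remainders are bounded uniformly in t by
    the common bound M, so they can be integrated directly, without a dominated convergence
    argument. The larger open interval gives two-sided continuity at a and b. *)
Lemma holomorphic_integral (F : V -> R -> R[i]) (x0 : V) r M (a' a b b' : R) :
  a' < a -> a <= b -> b < b' -> 0 < r ->
  (forall t, t \in `]a', b'[ -> holo_ball (fun x => F x t) x0 r M) ->
  (forall x t, `|x - x0| < r -> t \in `]a', b'[ -> {for t, continuous (F x)}) ->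
  [/\ differentiable (fun x => cint a b (F x)) x0,
      forall v, 'd (fun x => cint a b (F x)) x0 v =
        cint a b (fun t => 'd (fun x => F x t) x0 v) &
      forall v, continuous_itv a b (fun t => 'd (fun x => F x t) x0 v)].
Proof.
move=> a'a ab bb' r0 HF HC.
have itvS t : t \in `[a, b] -> t \in `]a', b'[.
  by rewrite !in_itv /= => /andP[t1 t2]; rewrite (lt_le_trans a'a)// (le_lt_trans t2).
have M0 : 0 <= M by apply: holo_ball_ge0 r0 (HF a _); apply: itvS; rewrite in_itv /= lexx.
have r40 : 0 < r / 4 by rewrite divr_gt0.
have r4r : r / 4 < r by rewrite ltr_pdivrMr// ltr_pMr// ltr1n.
set K2 := 2 * (8 * 32 * 4) * M / r ^+ 2.
have K20 : 0 <= K2 by rewrite divr_ge0 ?mulr_ge0 ?exprn_ge0// ltW.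
have ba0 : 0 <= (b - a)%:C :> R[i] by rewrite ler0c subr_ge0.
pose D v t : R[i] := 'd (fun x => F x t) x0 v.
(* The derivative is a uniform limit in t of difference quotients, each of which is continuous in
   t. *)
have cD v : continuous_itv a b (D v).
  move=> t /itvS tab; apply/cvgrPdist_lt => e e0.
  have e30 : 0 < e / 3 by rewrite divr_gt0.
  have n1 : 0 < `|v| + 1 by rewrite ltr_wpDl.
  have [s [s0 sr sK]] : exists s : R[i], [/\ 0 < s, s * `|v| <= r / 4 &
      K2 * s * `|v| ^+ 2 <= e / 3].
    (* The inverse of A + B lies below the inverses of both A and B, which avoids a minimum in the
       partially ordered [R[i]]; the added ones keep the quantities positive. *)
    pose A := (`|v| + 1) / (r / 4); pose B := (K2 + 1) * (`|v| + 1) ^+ 2 / (e / 3).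
    have A0 : 0 < A by rewrite divr_gt0.
    have B0 : 0 < B by rewrite divr_gt0// mulr_gt0 ?exprn_gt0// ltr_wpDl.
    have AB0 : 0 < A + B by rewrite addr_gt0.
    exists (A + B)^-1; split; first by rewrite invr_gt0.
      rewrite mulrC ler_pdivrMr// mulrDr (_ : r / 4 * A = `|v| + 1); last first.
        by rewrite /A mulrC divfK// gt_eqF.
      by rewrite -addrA lerDl addr_ge0// mulr_ge0// ltW.
    rewrite mulrAC ler_pdivrMr// mulrDr.
    rewrite (_ : e / 3 * B = (K2 + 1) * (`|v| + 1) ^+ 2); last first.
      by rewrite /B mulrC divfK// gt_eqF.
    rewrite (@le_trans _ _ ((K2 + 1) * (`|v| + 1) ^+ 2))//.
      by rewrite ler_pM ?exprn_ge0 ?lerDl// lerXn2r ?nnegrE ?lerDl// addr_ge0.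
    by rewrite lerDr mulr_ge0// ltW.
  have sv : `|s *: v| <= r / 4 by rewrite normrZ gtr0_norm.
  pose G t' : R[i] := s^-1 * (F (x0 + s *: v) t' - F x0 t').
  have q t' : t' \in `]a', b'[ -> `|D v t' - G t'| <= e / 3.
    move=> t'ab; apply: le_trans sK.
    rewrite -(ler_pM2l s0) -[X in X * `|_|](gtr0_norm s0) -normrM mulrBr mulVKf ?gt_eqF//.
    rewrite distrC -diff_scale (le_trans (holo_second_order r0 (HF _ t'ab) sv))//.
    by rewrite normrZ (gtr0_norm s0) -/K2 exprMn le_eqVlt; apply/orP; left; apply/eqP; ring.
  have cG : {for t, continuous G}.
    apply: continuousM; first exact: cst_continuous.
    apply: continuousB; apply: HC => //; rewrite ?subrr ?normr0//.
    by rewrite addrC addKr (le_lt_trans sv).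
  have /cvgrPdist_lt/(_ _ e30) := cG.
  apply: filterS2 (near_in_itvoo tab) => t' t'ab GG.
  exact: ltr_dist3 (q _ tab) GG (q _ t'ab).
pose L v := cint a b (D v).
have linL c u v : L (c *: u + v) = c * L u + L v.
  rewrite /L -cintZ; last exact: cD.
  rewrite -cintD; [|exact/continuous_itvZ/cD|exact: cD].
  by apply: eq_cint => t _; rewrite /D linearD linearZ.
have LK v : `|L v| <= 2 * (8 * M / r) * (b - a)%:C * `|v|.
  have -> : 2 * (8 * M / r) * (b - a)%:C * `|v| = 2 * (8 * M / r * `|v|) * (b - a)%:C by ring.
  apply: (cint_le ab (cD v)).
  by move=> t /itvS tab; exact: (cauchy_estimate v r0 (HF t tab)).
have cF x : `|x - x0| < r -> continuous_itv a b (F x).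
  by move=> xr t /itvS; exact: HC.
have rem v : `|v| < r / 4 -> `|cint a b (F (x0 + v)) - cint a b (F x0) - L v| <=
    2 * K2 * (b - a)%:C * `|v| ^+ 2.
  move=> vr.
  have c1 : continuous_itv a b (F (x0 + v)) by apply: cF; rewrite addrC addKr (lt_trans vr).
  have c2 : continuous_itv a b (F x0) by apply: cF; rewrite subrr normr0.
  have c3 := continuous_itvD c1 (continuous_itvN c2).
  rewrite -(cintB c1 c2) -(cintB c3 (cD v)).
  have -> : 2 * K2 * (b - a)%:C * `|v| ^+ 2 = 2 * (K2 * `|v| ^+ 2) * (b - a)%:C by ring.
  apply: (cint_le ab (continuous_itvD c3 (continuous_itvN (cD v)))).
  by move=> t /itvS tab; exact: (holo_second_order r0 (HF t tab) (ltW vr)).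
have [||d1 d2] :=
  @differentiable_quadratic (fun x => cint a b (F x)) L x0 (r / 4) _ _ r40 _ _ linL LK rem.
- by rewrite mulr_ge0// mulr_ge0// divr_ge0 ?mulr_ge0// ltW.
- by rewrite mulr_ge0// mulr_ge0.
by split.
Qed.

End HolomorphicIntegral.

Section NearDifferentiable.
Variable R : realType.
Variables V W : normedModType R[i].

Lemma near_normP (x : V) (P : V -> Prop) : (\forall y \near x, P y) <->
  exists2 r : R[i], 0 < r & forall y, `|y - x| < r -> P y.
Proof.
split=> [/nbhs_ballP[r r0 rP]|[r r0 rP]].
  by exists r => // y yr; apply: rP; rewrite -ball_normE /= distrC.
by apply/nbhs_ballP; exists r => // y; rewrite -ball_normE /= distrC; exact: rP.
Qed.

Lemma near_eq_differentiable (f g : V -> W) (x : V) : (\forall y \near x, f y = g y) ->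
  differentiable g x -> differentiable f x /\ 'd f x = 'd g x :> (V -> W).
Proof.
move=> /near_normP[r r0 fg] /diff_locallyP[cg gE].
have fxgx : f x = g x by apply: fg; rewrite subrr normr0.
have fE : f \o shift x = cst (f x) + 'd g x +
    landau.the_littleo landau.the_tag (nbhs_filter_on 0)
    (Phantom (set_system V) (nbhs 0)) (f \o shift x \- (cst (f x) + 'd g x)) id.
  apply/landau.eqaddoP => e e0.
  have nr : \forall v \near (0 : V), `|v| < r.
    by apply/near_normP; exists r => // v; rewrite subr0.
  move/landau.eqaddoP : gE => /(_ e e0); apply: filterS2 nr => v vr.
  rewrite !fctE /= fxgx fg//.
  by rewrite addrK.
have dE := diff_unique cg fE; split; last exact: dE.
by apply/diff_locallyP; rewrite dE; split; [exact: cg | exact: fE].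
Qed.

End NearDifferentiable.

(** * Holomorphy of the derivative *)

Section HolomorphicDerivative.
Variable R : realType.
Variable V : normedModType R[i].
Implicit Types (f : V -> R[i]) (x v : V) (r M K : R[i]).

Lemma near_holo_ball f x0 : (\forall x \near x0, differentiable f x) ->
  exists r M, 0 < r /\ holo_ball f x0 r M.
Proof.
move=> /near_normP[r r0 fr].
have /differentiable_continuous : differentiable f x0 by apply: fr; rewrite subrr normr0.
move=> /cvgrPdist_lt/(_ 1 ltr01)/near_normP[r' r'0 fr'].
have c : (r >=< r')%R by rewrite real_comparable// gtr0_real.
exists (Num.min r r'), (`|f x0| + 1); split.
  by rewrite comparable_lt_min// r0.
move=> x; rewrite comparable_lt_min// => /andP[/fr ? /fr' H]; split=> //.
rewrite -[f x](subrK (f x0)) (le_trans (ler_normD _ _))// addrC lerD2l.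
by rewrite distrC ltW.
Qed.

(** By [diff_circle] the derivative along v is an integral of values of f, in which the centre of
    the circle enters holomorphically; [holomorphic_integral] then applies. *)
Lemma holo_ball_diff f x0 r M v : 0 < r -> holo_ball f x0 r M ->
  differentiable (fun y => 'd f y v) x0.
Proof.
move=> r0 fr; have M0 := holo_ball_ge0 r0 fr.
have n1 : 0 < `|v| + 1 by rewrite ltr_wpDl.
(* Shrinks v so that the unit disc directed by [s *: v] around any point of the half ball stays in
   the full ball. *)
pose s : R[i] := (r / 2) / (`|v| + 1).
have r20 : 0 < r / 2 by rewrite divr_gt0.
have s0 : 0 < s by rewrite divr_gt0.
have svr : `|s *: v| <= r / 2.
  rewrite normrZ gtr0_norm// /s mulrAC ler_pdivrMr// ler_pM2l//.
  by rewrite lerDl.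
pose F (y : V) (t : R) : R[i] := (f (y + cis t *: (s *: v)) - f y) / cis t.
have near_r (y : V) (z : R[i]) : `|y - x0| < r / 2 -> `|z| <= 1 -> `|y + z *: (s *: v) - x0| < r.
  move=> yr z1; rewrite addrAC (le_lt_trans (ler_normD _ _))// [ltRHS]splitr ltr_leD//.
  by rewrite normrZ (le_trans _ svr)// ler_piMl.
have r2r : r / 2 < r by rewrite ltr_pdivrMr// ltr_pMr// ltr1n.
have FE (y : V) : `|y - x0| < r / 2 ->
    'd f y v = (s^-1 / (2 * pi)%:C) * cint 0 (2 * pi) (F y).
  move=> yr; rewrite /F diff_circle; last first.
    by move=> z z1; have [] := fr _ (near_r y z yr z1).
  by rewrite mulrA divfK ?gt_eqF ?twopi_gt0// diff_scale mulKf// gt_eqF.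
have FH t : t \in `](-1)%R, (2 * pi + 1)%R[ -> holo_ball (fun y => F y t) x0 (r / 2) (M + M).
  move=> _ y yr.
  have c1 : `|cis t| <= 1 by rewrite normr_cis.
  have [d1 b1] := fr _ (near_r y (cis t) yr c1).
  have [d2 b2] := fr _ (lt_trans yr r2r).
  split; last first.
    rewrite normrM normfV normr_cis invr1 mulr1 (le_trans (ler_normB _ _))//.
    exact: lerD.
  apply: differentiableM; last exact: differentiable_cst.
  by apply: differentiableB; [exact: differentiable_shift | exact: d2].
have FC (y : V) t : `|y - x0| < r / 2 -> t \in `](-1)%R, (2 * pi + 1)%R[ -> {for t, continuous (F y)}.
  move=> yr _; apply: continuous_circle => z z1.
  by have [] := fr _ (near_r y z yr z1).
have p0 : 0 <= 2 * pi :> R by rewrite mulr_ge0// pi_ge0.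
have m10 : -1 < 0 :> R by rewrite ltrN10.
have p1 : 2 * pi < 2 * pi + 1 :> R by rewrite ltrDl.
have [dF _ _] := holomorphic_integral m10 p0 p1 r20 FH FC.
apply: (near_eq_differentiable (g := fun y => (s^-1 / (2 * pi)%:C) * cint 0 (2 * pi) (F y)) _ _).1.
  by apply/near_normP; exists (r / 2).
by apply: differentiableM.
Qed.

Lemma holomorphic_diff f x0 v : (\forall x \near x0, differentiable f x) ->
  \forall x \near x0, differentiable (fun y => 'd f y v) x.
Proof.
move=> /near_holo_ball[r [M [r0 fr]]]; apply/near_normP; exists (r / 2).
  by rewrite divr_gt0.
move=> x xr; have r20 : 0 < r / 2 by rewrite divr_gt0.
apply: (holo_ball_diff v r20 (holo_ballS (x1 := x) (r1 := r / 2) fr _)).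
by rewrite [leRHS]splitr lerD2r ltW.
Qed.

End HolomorphicDerivative.

(** * The implicit function theorem *)

Section ProductNorm.
Variable R : realType.
Variable W : normedModType R[i].
Local Notation V := (W * R[i] : normedModType R[i])%type.
Implicit Types (x : W) (s r : R[i]).

(** The product norm is a maximum in the partial order of [R[i]], which obeys the usual laws only
    for comparable arguments. *)
Lemma prod_norm_cmp x s : `|x| >=< `|s|.
Proof. by rewrite real_comparable// ger0_real. Qed.

Lemma prod_norm_lt x s r : (`|(x, s) : V| < r) = (`|x| < r) && (`|s| < r).
Proof. by rewrite prodnormedzmodule.ProdNormedZmodule.prod_normE comparable_gt_max// prod_norm_cmp. Qed.

Lemma prod_norm_le x s r : (`|(x, s) : V| <= r) = (`|x| <= r) && (`|s| <= r).
Proof. by rewrite prodnormedzmodule.ProdNormedZmodule.prod_normE comparable_ge_max// prod_norm_cmp. Qed.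

End ProductNorm.

Section ImplicitFunction.
Variable R : realType.
Variable W : normedModType R[i].
Local Notation V := (W * R[i] : normedModType R[i])%type.

(* Otherwise [g^-1] would be holomorphic and equal to its mean over the circle. *)
Lemma circle_zero (g : R[i] -> R[i]) (m : R[i]) : 0 < m ->
  (forall z, `|z| <= 1 -> differentiable g z) ->
  (forall z, `|z| = 1 -> m <= `|g z|) -> `|g 0| < m / 2 ->
  exists2 z, `|z| <= 1 & g z = 0.
Proof.
move=> m0 dg gm g0m; apply: contrapT => nz.
have gn0 z : `|z| <= 1 -> g z != 0.
  by move=> z1; apply/eqP => gz; apply: nz; exists z.
pose k (z : R[i]) : R[i] := (g z)^-1.
have dk z : `|z| <= 1 -> differentiable k z.
  by move=> z1; apply: differentiableV; [exact: dg | exact: gn0].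
have := circle_mean dk => /(congr1 Num.norm).
have p0 := @twopi_gt0 R.
have pi0 : 0 <= 2 * pi :> R by rewrite mulr_ge0// pi_ge0.
have H : `|cint 0 (2 * pi) (fun y => k (cis y))| <= 2 * m^-1 * (2 * pi - 0)%:C.
  apply: cint_le => //.
    move=> y _; apply: (@continuous_comp _ _ _ (@cis R) k).
      exact: continuous_cis.
    by apply/differentiable_continuous/dk; rewrite normr_cis.
  by move=> y _; rewrite normfV lef_pV2 ?posrE ?normr_gt0 ?gn0 ?gm// normr_cis.
move=> E; move: H; rewrite E normrM (gtr0_norm p0) subr0 [_ * (2 * pi)%:C]mulrC ler_pM2l//.
rewrite /k normfV -[2 * m^-1]invrK lef_pV2 ?posrE ?normr_gt0 ?gn0 ?normr0//; last first.
  by rewrite invr_gt0 mulr_gt0// invr_gt0.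
by rewrite invfM invrK mulrC => /le_lt_trans/(_ g0m); rewrite ltxx.
Qed.

(** For x near x0 a zero in s exists by [circle_zero]. The lower bound [strict] makes it unique in
    the disc and gives its Lipschitz dependence on x; the second-order expansion of F at the zero
    then yields differentiability. *)
Lemma implicit_function (F : V -> R[i]) (x0 : W) (s0 : R[i]) :
  (\forall p \near ((x0, s0) : V), differentiable F p) ->
  F (x0, s0) = 0 -> 'd F (x0, s0) (0, 1) != 0 ->
  exists sigma : W -> R[i], [/\ \forall x \near x0, differentiable sigma x,
    sigma x0 = s0 & \forall x \near x0, F (x, sigma x) = 0].
Proof.
move=> dF F0 c0; pose p0 : V := (x0, s0); rewrite -/p0 in dF F0 c0.
pose c := 'd F p0 (0, 1); rewrite -/c in c0.
have nc0 : 0 < `|c| by rewrite normr_gt0.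
have c40 : 0 < `|c| / 4 by rewrite divr_gt0.
have [r [M [r0 Fr]]] := near_holo_ball dF.
have M0 := holo_ball_ge0 r0 Fr.
have r20 : 0 < r / 2 by rewrite divr_gt0.
(* The partial derivative in s varies by at most |c| / 4; doubled by [mean_value_le], this still
   leaves the lower bound |c| / 2 in [strict]. *)
have [rho rho0 rhoP] : exists2 rho : R[i], 0 < rho &
    forall p : V, `|p - p0| < rho -> `|p - p0| < r / 2 /\ `|'d F p (0, 1) - c| <= `|c| / 4.
  apply/near_normP.
  have H1 : \forall p \near (p0 : V), `|p - p0| < r / 2 by apply/near_normP; exists (r / 2).
  have := nbhs_singleton (@holomorphic_diff _ V F p0 (0, 1) dF).
  move=> /differentiable_continuous/cvgrPdist_le/(_ _ c40); apply: filterS2 H1.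
  by move=> p pr H; split; [exact: pr | rewrite distrC; exact: H].
have rhoE x s : `|x - x0| < rho -> `|s - s0| < rho -> `|((x, s) : V) - p0| < rho.
  by move=> xr sr; rewrite -[_ - p0]/(x - x0, s - s0) prod_norm_lt xr.
have Fp (p : V) : `|p - p0| < rho -> holo_ball F p (r / 2) M.
  move=> /rhoP[pr _]; apply: holo_ballS Fr _.
  by rewrite [leRHS]splitr lerD2r ltW.
have dFp (p : V) : `|p - p0| < rho -> differentiable F p.
  by move=> /Fp H; have [] := H p; rewrite ?subrr ?normr0.
have dist_rho (s s' : R[i]) (t : R) : 0 <= t <= 1 -> `|s - s0| < rho -> `|s' - s0| < rho ->
    `|s' + t%:C * (s - s') - s0| < rho.
  move=> /andP[t0 t1] sr s'r.
  have -> : s' + t%:C * (s - s') - s0 = t%:C * (s - s0) + (1 - t)%:C * (s' - s0).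
    by rewrite rmorphB; ring.
  have [->|tn0] := eqVneq t 0; first by rewrite mul0r add0r subr0 mul1r.
  have tp : 0 < t by rewrite lt_def tn0.
  rewrite (le_lt_trans (ler_normD _ _))// !normrM !normr_real_complex (ger0_norm t0).
  rewrite (_ : `|1 - t| = 1 - t); last by rewrite ger0_norm// subr_ge0.
  have -> : rho = t%:C * rho + (1 - t)%:C * rho by rewrite rmorphB; ring.
  apply: ltr_leD; first by rewrite ltr_pM2l ?ltcR.
  by apply: ler_wpM2l; [rewrite ler0c subr_ge0 | exact: ltW].
have strict x s s' : `|x - x0| < rho -> `|s - s0| < rho -> `|s' - s0| < rho ->
    `|c| / 2 * `|s - s'| <= `|F (x, s) - F (x, s')|.
  move=> xr sr s'r.
  have : `|F ((x, s') + (0, s - s')) - F (x, s') - c * (s - s')| <= 2 * (`|c| / 4 * `|s - s'|).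
    have pt (t : R) : (x, s') + t%:C *: (0, s - s') = (x, s' + t%:C * (s - s')) :> V.
      by rewrite -[RHS]/(_, _) -[LHS]/(x + t%:C *: 0, s' + t%:C *: (s - s')) scaler0 addr0.
    apply: mean_value_le => t t01; rewrite pt.
      by apply/dFp/rhoE => //; exact: dist_rho.
    have -> : (0, s - s') = (s - s') *: (0, 1) :> V.
      by rewrite -[RHS]/((s - s') *: 0, (s - s') *: 1) scaler0 [_ *: 1]mulr1.
    rewrite diff_scale mulrC -mulrBl normrM ler_wpM2r//.
    have [_] := rhoP (x, s' + t%:C * (s - s')) (rhoE _ _ xr (dist_rho _ _ _ t01 sr s'r)).
    by [].
  have -> : (x, s') + (0, s - s') = (x, s) :> V.
    by rewrite -[LHS]/(x + 0, s' + (s - s')) addr0 [s' + _]addrC subrK.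
  move=> H.
  rewrite -(lerD2r (`|c| / 2 * `|s - s'|)).
  have -> : `|c| / 2 * `|s - s'| + `|c| / 2 * `|s - s'| = `|c * (s - s')|.
    by rewrite normrM; field.
  rewrite -[c * _](subKr (F (x, s) - F (x, s'))) (le_trans (ler_normB _ _))// lerD2l.
  by rewrite (le_trans H)// le_eqVlt; apply/orP; left; apply/eqP; field.
pose delta := rho / 2.
have delta0 : 0 < delta by rewrite divr_gt0.
have delta_rho : delta < rho by rewrite ltr_pdivrMr// ltr_pMr// ltr1n.
(* On the circle of radius delta, |F| is at least |c| delta / 2 minus |F (x, s0)|. Keeping the
   latter below |c| delta / 8 leaves more than |c| delta / 4, and the value at the centre is below
   half of that. *)
have m0 : 0 < `|c| * delta / 4 by rewrite divr_gt0// mulr_gt0.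
have s0r (s : R[i]) : `|s - s0| <= delta -> `|s - s0| < rho by move=> /le_lt_trans; apply.
have [rho1 rho10 ex_zero] : exists2 rho1 : R[i], 0 < rho1 & forall x, `|x - x0| < rho1 ->
    `|x - x0| < rho /\ exists2 s, `|s - s0| <= delta & F (x, s) = 0.
  have m20 : 0 < `|c| * delta / 4 / 2 by rewrite divr_gt0.
  have cF : {for x0, continuous (fun x => F (x, s0))}.
    apply: (@continuous_comp _ _ _ (fun x => (x, s0) : V) F).
      by apply/differentiable_continuous/differentiable_pair => //; exact: differentiable_cst.
    by apply/differentiable_continuous/dFp; rewrite subrr normr0.
  apply/near_normP.
  have H1 : \forall x \near x0, `|x - x0| < rho by apply/near_normP; exists rho.
  move: cF => /cvgrPdist_lt/(_ _ m20); apply: filterS2 H1 => x xr.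
  rewrite F0 sub0r normrN => Fx; split=> //.
  have zr (z : R[i]) : `|z| <= 1 -> `|s0 + z * delta - s0| <= delta.
    by move=> z1; rewrite addrC addKr normrM (gtr0_norm delta0) ler_piMl// ltW.
  have [||||z z1 Fz] := @circle_zero (fun z => F (x, s0 + z * delta)) (`|c| * delta / 4).
  - exact: m0.
  - move=> z /zr/s0r zr'.
    apply: (@differentiable_comp _ _ _ _ (fun z : R[i] => (x, s0 + z * delta) : V) F).
      apply: differentiable_pair; first exact: differentiable_cst.
      apply: differentiableD; first exact: differentiable_cst.
      apply: differentiableM; [by []|exact: differentiable_cst].
    exact/dFp/rhoE.
  - move=> z z1; have zr' : `|s0 + z * delta - s0| = delta.
      by rewrite addrC addKr normrM z1 mul1r gtr0_norm.
    have := strict x (s0 + z * delta) s0 xr; rewrite zr' subrr normr0 => /(_ delta_rho rho0) H.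
    have := le_trans H (ler_normB _ _); rewrite -lerBlDr; apply: le_trans.
    rewrite lerBrDr (le_trans (lerD (lexx _) (ltW Fx)))//.
    rewrite -subr_ge0 (_ : _ - _ = `|c| * delta / 8); last by field.
    by rewrite divr_ge0// mulr_ge0// ltW.
  - by rewrite mul0r addr0.
  - by exists (s0 + z * delta); [exact: zr | exact: Fz].
(* The zeros are chosen pointwise, with default value s0 away from x0; no regularity is built in. *)
have sigma_ex x : exists s, `|x - x0| < rho1 -> `|s - s0| <= delta /\ F (x, s) = 0.
  have [/ex_zero[_ [s s1 s2]]|?] := pselect (`|x - x0| < rho1); last by exists s0.
  by exists s.
have [sigma sigmaP] := choice sigma_ex.
have x0r : `|x0 - x0| < rho1 by rewrite subrr normr0.
have sigma0 : sigma x0 = s0.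
  have [sd sF] := sigmaP x0 x0r.
  have := strict x0 (sigma x0) s0; rewrite sF F0 !subrr !normr0.
  move=> /(_ rho0 (s0r _ sd) rho0); rewrite pmulr_rle0 ?divr_gt0// normr_le0 subr_eq0.
  by move=> /eqP.
exists sigma; split => //; last first.
  by apply/near_normP; exists rho1 => // x /sigmaP[].
apply/near_normP; exists rho1 => // x xr1.
have [xr _] := ex_zero x xr1; have [sd sF] := sigmaP x xr1.
set p : V := (x, sigma x) in sF.
have pr : `|p - p0| < rho by apply: rhoE => //; exact: s0r.
have Hp := Fp p pr; have [_ dpc] := rhoP p pr.
pose d := 'd F p (0, 1).
have d0 : d != 0.
  apply/eqP => d0; move: dpc; rewrite -/d d0 sub0r normrN.
  by rewrite ler_pdivlMr// ger_pMr// lern1.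
pose L (h : W) : R[i] := - (d^-1 * 'd F p (h, 0)).
(* [A] is the Lipschitz constant of F near p; divided by the lower bound |c| / 2 of [strict], it
   bounds the variation of [sigma]. *)
pose A := 32 * M / (r / 2).
have A0 : 0 <= A by apply: divr_ge0; [rewrite mulr_ge0 | exact: ltW].
pose B := A / (`|c| / 2).
have B0 : 0 <= B by rewrite divr_ge0// divr_ge0.
pose K2 := 2 * (8 * 32 * 4) * M / (r / 2) ^+ 2.
have K20 : 0 <= K2.
  by apply: divr_ge0; [rewrite !mulr_ge0 | rewrite exprn_ge0// ltW].
have nd0 : 0 < `|d| by rewrite normr_gt0.
have id0 : 0 <= `|d|^-1 by rewrite invr_ge0 ltW.
have linL cc u v : L (cc *: u + v) = cc * L u + L v.
  have -> : L (cc *: u + v) = - (d^-1 * 'd F p (cc *: ((u, 0) : V) + (v, 0))).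
    congr (- (_ * 'd F p _)).
    by rewrite -[RHS]/(cc *: u + v, cc *: 0 + 0) scaler0 addr0.
  by rewrite linearD diff_scale /L; ring.
have nh0 (h : W) : `|(h, 0) : V| <= `|h| by rewrite prod_norm_le lexx normr0 normr_ge0.
have LK v : `|L v| <= `|d|^-1 * (8 * M / (r / 2)) * `|v|.
  rewrite /L normrN normrM normfV -[leRHS]mulrA.
  apply: (ler_wpM2l id0).
  apply: le_trans (cauchy_estimate _ r20 Hp) _; apply: ler_wpM2l (nh0 v).
  by apply: divr_ge0; [rewrite mulr_ge0 | exact: ltW].
(* The first term keeps [x + v] where [sigma] solves the equation; the second keeps the joint
   increment (v, k), of norm at most (1 + B) |v|, where the second-order estimate holds. *)
pose radius := Num.min (rho1 - `|x - x0|) ((r / 2 / 4) / (1 + B)).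
have radius_cmp : (rho1 - `|x - x0| >=< (r / 2 / 4) / (1 + B))%R.
  rewrite real_comparable// gtr0_real// ?subr_gt0// divr_gt0 ?divr_gt0//.
  by rewrite ltr_wpDr.
have B1 : 0 < 1 + B by rewrite ltr_wpDr.
have radius0 : 0 < radius.
  by rewrite comparable_lt_min// subr_gt0 xr1 divr_gt0// divr_gt0.
have rem v : `|v| < radius -> `|sigma (x + v) - sigma x - L v| <=
    `|d|^-1 * (K2 * (1 + B) ^+ 2) * `|v| ^+ 2.
  rewrite comparable_lt_min// ltrBrDr ltr_pdivlMr// => /andP[vr1 vr2].
  have xvr1 : `|x + v - x0| < rho1 by rewrite addrAC (le_lt_trans (ler_normD _ _))// [ltLHS]addrC.
  have [xvr _] := ex_zero _ xvr1; have [sd' sF'] := sigmaP _ xvr1.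
  pose k := sigma (x + v) - sigma x.
  have vB : `|v| <= `|v| * (1 + B) by rewrite ler_peMr// lerDl.
  have kB : `|k| <= B * `|v|.
    have := strict (x + v) (sigma (x + v)) (sigma x) xvr (s0r _ sd') (s0r _ sd).
    rewrite sF' sub0r normrN -/k => H.
    have E : (x + v, sigma x) = p + (v, 0) :> V by rewrite -[RHS]/(x + v, sigma x + 0) addr0.
    have r8 : r / 2 / 4 <= r / 2 / 2.
      by rewrite ler_pM2l// lef_pV2 ?posrE// ler_nat.
    have := @holo_lipschitz _ _ F p (r / 2) M (x + v, sigma x) p r20 Hp.
    rewrite sF subr0 E addrC addKr subrr normr0 -E => lip.
    have lip2 : `|F (x + v, sigma x)| <= A * `|v|.
      apply: le_trans (lip _ _) _.
      - apply: le_trans (nh0 v) _; apply: le_trans vB _; apply: le_trans (ltW vr2) _.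
        exact: r8.
      - by apply: ltW; rewrite divr_gt0.
      - exact: ler_wpM2l A0 _ _ (nh0 v).
    have c20 : 0 < `|c| / 2 by rewrite divr_gt0.
    have BE : `|c| / 2 * (B * `|v|) = A * `|v|.
      by rewrite mulrA [_ * B]mulrC /B divfK// gt_eqF.
    by rewrite -(ler_pM2l c20) BE; exact: le_trans H lip2.
  have hk : `|(v, k) : V| <= (1 + B) * `|v|.
    rewrite prod_norm_le [_ * `|v|]mulrC vB/= (le_trans kB)// mulrC ler_wpM2l//.
    by rewrite lerDr.
  have hkr : `|(v, k) : V| <= r / 2 / 4.
    by rewrite (le_trans hk)// mulrC ltW.
  have := holo_second_order r20 Hp hkr.
  have -> : p + (v, k) = (x + v, sigma (x + v)) :> V.
    by rewrite -[LHS]/(x + v, sigma x + k) /k [sigma x + _]addrC subrK.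
  rewrite sF sF' subrr sub0r normrN => H.
  have Dvk : 'd F p (v, k) = 'd F p (v, 0) + k * 'd F p (0, 1).
    have -> : ((v, k) : V) = (v, 0) + k *: (0, 1).
      by rewrite -[RHS]/(v + k *: 0, 0 + k *: 1) scaler0 addr0 add0r [_ *: 1]mulr1.
    by rewrite linearD diff_scale.
  rewrite Dvk in H.
  have -> : sigma (x + v) - sigma x - L v = d^-1 * ('d F p (v, 0) + k * 'd F p (0, 1)).
    by rewrite -/k /L opprK -/d mulrDr mulrCA mulVf// mulr1 addrC.
  rewrite normrM normfV -[leRHS]mulrA; apply: (ler_wpM2l id0).
  apply: (le_trans H); rewrite -[leRHS]mulrA ler_wpM2l// -exprMn lerXn2r ?nnegrE//.
  by rewrite mulr_ge0// ltW.
have [||dsig _] := @differentiable_quadratic _ _ sigma L x radius _ _ radius0 _ _ linL LK rem.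
- by apply: (mulr_ge0 id0); apply: divr_ge0; [rewrite mulr_ge0 | exact: ltW].
- exact: mulr_ge0 id0 (mulr_ge0 K20 (exprn_ge0 _ (ltW B1))).
exact: dsig.
Qed.

End ImplicitFunction.

(** * Alternating forms and Jacobians *)

Section AlternatingForms.
Variables (R : realType) (r : nat).
Implicit Types (a : ('I_r -> 'rV[R[i]]_r) -> R[i]) (v : 'I_r -> 'rV[R[i]]_r).

Definition slot v (i : 'I_r) (u : 'rV[R[i]]_r) := fun j => if j == i then u else v j.

Lemma slot_same v i : slot v i (v i) = v.
Proof. by apply/funext => j; rewrite /slot; case: eqP => [->|]. Qed.

Lemma multilinear_slot0 a v i : multilinear a -> a (slot v i 0) = 0.
Proof.
move=> ma; have := ma v i 1 0 0; rewrite scaler0 addr0 mul1r -/(slot v i 0) => /eqP.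
by rewrite -subr_eq0 opprD addrA subrr sub0r oppr_eq0 => /eqP.
Qed.

Lemma multilinear_slot_sum a v i (I : finType) (c : I -> R[i]) (w : I -> 'rV[R[i]]_r) :
  multilinear a -> a (slot v i (\sum_j c j *: w j)) = \sum_j c j * a (slot v i (w j)).
Proof.
move=> ma; elim/big_rec2: _ => [|j y1 y2 _ <-]; first exact: multilinear_slot0.
exact: ma.
Qed.

Lemma alternating_tperm a v (i j : 'I_r) : multilinear a -> Defs.alternating a -> i != j ->
  a (v \o tperm i j) = - a v.
Proof.
move=> ma aa ij.
pose w x y := slot (slot v i x) j y.
have wD1 x x' y : a (w (x + x') y) = a (w x y) + a (w x' y).
  have E z : w z y = slot (slot v j y) i z.
    apply/funext => k; rewrite /w /slot; case: (eqVneq k j) => [->|//].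
    by rewrite eq_sym (negbTE ij).
  by rewrite !E; have := ma (slot v j y) i 1 x x'; rewrite scale1r mul1r.
have wD2 x y y' : a (w x (y + y')) = a (w x y) + a (w x y').
  by have := ma (slot v i x) j 1 y y'; rewrite scale1r mul1r.
have w0 x : a (w x x) = 0.
  by apply: (aa _ i j ij); rewrite /w /slot !eqxx (negbTE ij).
have := w0 (v i + v j); rewrite wD1 !wD2 !w0 add0r addr0 => /eqP.
rewrite addrC addr_eq0 => /eqP wji.
have -> : v \o tperm i j = w (v j) (v i).
  apply/funext => k; rewrite /w /slot /=; case: tpermP => [->|->|/eqP ki /eqP kj].
  - by rewrite (negbTE ij) eqxx.
  - by rewrite eqxx.
  - by rewrite (negbTE ki) (negbTE kj).
by rewrite wji /w !slot_same.
Qed.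

Lemma alternating_eq0 a : multilinear a -> Defs.alternating a ->
  a (fun k => delta_mx 0 k) = 0 -> forall v, a v = 0.
Proof.
move=> ma aa a0.
have perm_case (s : 'S_r) v : a v = 0 -> a (v \o s) = 0.
  have [ts -> dts] := prod_tpermP s.
  elim/last_ind: ts dts v => [|ts t ih] dts v av.
    rewrite big_nil; rewrite (_ : v \o _ = v)//.
    by apply/funext => k; rewrite /= perm1.
  rewrite big_rcons /=.
  move: dts; rewrite all_rcons => /andP[dt dts].
  set s' := (\prod_(t <- ts) _)%g.
  have -> : v \o (s' * tperm t.1 t.2)%g = (v \o tperm t.1 t.2) \o s'.
    by apply/funext => k; rewrite /= permM.
  by apply: ih => //; rewrite alternating_tperm// av oppr0.
have basis_case (g : {ffun 'I_r -> 'I_r}) : a (fun k => delta_mx 0 (g k)) = 0.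
  have [/injectiveP gi|/injectivePn[i [j ij gij]]] := boolP (injectiveb g).
    have -> : (fun k => delta_mx 0 (g k)) = (fun k => delta_mx 0 k) \o perm gi :> ('I_r -> 'rV[R[i]]_r).
      by apply/funext => k; rewrite /= permE.
    exact: perm_case.
  by apply: (aa _ i j ij); rewrite gij.
(* Slots from m on hold basis vectors already. The induction expands the slot m on the basis, so
   that m = r covers arbitrary vectors. *)
have key (m : nat) : forall v (g : {ffun 'I_r -> 'I_r}),
    (forall k : 'I_r, (m <= k)%N -> v k = delta_mx 0 (g k)) -> a v = 0.
  elim: m => [|m ih] v g vg.
    rewrite (_ : v = fun k => delta_mx 0 (g k)) ?basis_case//.
    by apply/funext => k; exact: vg.
  have [mr|rm] := ltnP m r; last first.
    by apply: (ih _ g) => k mk; have := leq_trans (ltn_ord k) (leq_trans rm mk); rewrite ltnn.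
  pose i := Ordinal mr.
  rewrite -(slot_same v i) (row_sum_delta (v i)) multilinear_slot_sum// big1// => j _.
  rewrite (ih (slot v i (delta_mx 0 j)) [ffun k => if k == i then j else g k]) ?mulr0//.
  move=> k; rewrite leq_eqVlt ffunE /slot => /orP[/eqP mk|mk].
    by rewrite (_ : k == i)//; apply/eqP/val_inj.
  case: eqP => // _; exact: vg.
move=> v; apply: (key r v [ffun k => k]) => k rk.
by have := leq_trans (ltn_ord k) rk; rewrite ltnn.
Qed.

(** The difference of the two sides is again multilinear and alternating, and it vanishes on the
    standard basis. *)
Lemma alternating_det a v : multilinear a -> Defs.alternating a ->
  a v = \det (\matrix_(k, j) v k 0 j) * a (fun k => delta_mx 0 k).
Proof.
move=> ma aa; pose e := a (fun k => delta_mx 0 k); rewrite -/e.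
pose D v := a v - \det (\matrix_(k, j) v k 0 j) * e.
apply/eqP; rewrite -subr_eq0; apply/eqP.
rewrite -/(D v).
have mD : multilinear D.
  move=> {}v i c u w; rewrite /D -/(slot v i _) -/(slot v i u) -/(slot v i w).
  rewrite (ma v i c u w) -/(slot v i u) -/(slot v i w).
  have -> : \det (\matrix_(k, j) slot v i (c *: u + w) k 0 j) =
    c * \det (\matrix_(k, j) slot v i u k 0 j) + 1 * \det (\matrix_(k, j) slot v i w k 0 j).
    apply: (determinant_multilinear (i0 := i)).
    - by apply/rowP => j; rewrite !mxE /slot eqxx !mxE mul1r.
    - by apply/matrixP => k j; rewrite !mxE /slot eq_sym (negbTE (neq_lift _ _)).
    - by apply/matrixP => k j; rewrite !mxE /slot eq_sym (negbTE (neq_lift _ _)).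
  by ring.
have aD : Defs.alternating D.
  move=> {}v i j ij vij; rewrite /D (aa v i j ij vij).
  rewrite (determinant_alternate ij) ?mul0r ?subr0// => k.
  by rewrite !mxE vij.
suff D0 : D (fun k => delta_mx 0 k) = 0 by exact: (alternating_eq0 mD aD D0).
rewrite /D (_ : \matrix_(k, j) _ = 1%:M) ?det1 ?mul1r ?subrr//.
by apply/matrixP => k j; rewrite !mxE eqxx eq_sym.
Qed.

End AlternatingForms.

(** * Differential calculus of matrix-valued maps *)

Section MatrixValued.
Variable R : realType.
Variable V : normedModType R[i].
Implicit Types (x v : V).

Lemma differentiable_big_sum (I : Type) (s : seq I) (P : pred I) (F : I -> V -> R[i]) x :
  (forall i, differentiable (F i) x) ->
  differentiable (fun y => \sum_(i <- s | P i) F i y) x.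
Proof.
move=> dF; elim: s => [|i s ih].
  rewrite (_ : (fun y => _) = cst (0 : R[i])); first exact: differentiable_cst.
  by apply/funext => y; rewrite big_nil.
case Pi : (P i).
  rewrite (_ : (fun y => _) = (fun y => F i y + \sum_(j <- s | P j) F j y)).
    by apply: differentiableD; [exact: dF | exact: ih].
  by apply/funext => y; rewrite big_cons Pi.
rewrite (_ : (fun y => _) = (fun y => \sum_(j <- s | P j) F j y))//.
by apply/funext => y; rewrite big_cons Pi.
Qed.

Lemma differentiable_big_prod (I : Type) (s : seq I) (P : pred I) (F : I -> V -> R[i]) x :
  (forall i, differentiable (F i) x) ->
  differentiable (fun y => \prod_(i <- s | P i) F i y) x.
Proof.
move=> dF; elim: s => [|i s ih].
  rewrite (_ : (fun y => _) = cst (1 : R[i])); first exact: differentiable_cst.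
  by apply/funext => y; rewrite big_nil.
case Pi : (P i).
  rewrite (_ : (fun y => _) = (fun y => F i y * \prod_(j <- s | P j) F j y)).
    by apply: differentiableM; [exact: dF | exact: ih].
  by apply/funext => y; rewrite big_cons Pi.
rewrite (_ : (fun y => _) = (fun y => \prod_(j <- s | P j) F j y))//.
by apply/funext => y; rewrite big_cons Pi.
Qed.

Lemma differentiable_entry m n (A : V -> 'M[R[i]]_(m, n)) x i j :
  differentiable A x -> differentiable (fun y => A y i j : R[i]) x.
Proof.
move=> dA; apply: (@differentiable_comp _ _ _ _ A (fun N : 'M[R[i]]_(m, n) => N i j : R[i])).
  exact: dA.
exact: differentiable_coord.
Qed.

Lemma differentiable_mx m n (A : V -> 'M[R[i]]_(m, n)) x :
  (forall i j, differentiable (fun y => A y i j : R[i]) x) -> differentiable A x.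
Proof.
move=> dA.
have -> : A = \sum_i (\sum_j (fun y => A y i j *: delta_mx i j)).
  apply/funext => y; rewrite fct_sumE {1}(matrix_sum_delta (A y)).
  by apply: eq_bigr => i _; rewrite fct_sumE.
apply: differentiable_sum => i; apply: differentiable_sum => j.
exact: differentiableZl.
Qed.

Lemma differentiable_mulmx m n p (A : V -> 'M[R[i]]_(m, n)) (B : V -> 'M[R[i]]_(n, p)) x :
  differentiable A x -> differentiable B x -> differentiable (fun y => A y *m B y) x.
Proof.
move=> dA dB; apply: differentiable_mx => i j.
rewrite (_ : (fun y => _) = (fun y => \sum_k A y i k * B y k j : R[i])); last first.
  by apply/funext => y; rewrite mxE.
apply: differentiable_big_sum => k.
by apply: differentiableM; exact: differentiable_entry.
Qed.

Lemma differentiable_det n (A : V -> 'M[R[i]]_n) x :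
  (forall i j, differentiable (fun y => A y i j : R[i]) x) ->
  differentiable (fun y => \det (A y) : R[i]) x.
Proof.
move=> dA; apply: differentiable_big_sum => s.
apply: differentiableM; first exact: differentiable_cst.
exact: differentiable_big_prod.
Qed.

(** Cramer's formula. It describes [invmx] only at invertible matrices, since a singular matrix is
    returned unchanged; hence the condition on a whole neighbourhood. *)
Lemma differentiable_invmx n (A : V -> 'M[R[i]]_n) x : differentiable A x ->
  (\forall y \near x, A y \in unitmx) -> differentiable (fun y => invmx (A y)) x.
Proof.
move=> dA uA.
pose B y := (\det (A y))^-1 *: \adj (A y).
have dB : differentiable B x.
  apply: differentiable_mx => i j.
  rewrite (_ : (fun y => _) = (fun y => (\det (A y))^-1 * cofactor (A y) j i : R[i])); last first.
    by apply/funext => y; rewrite /B !mxE.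
  apply: differentiableM.
    apply: differentiableV.
      by apply: differentiable_det => k l; exact: differentiable_entry.
    by have := nbhs_singleton uA; rewrite unitmxE unitfE.
  apply: differentiableM; first exact: differentiable_cst.
  apply: differentiable_det => k l.
  rewrite (_ : (fun y => _) = (fun y => A y (lift j k) (lift i l))); last first.
    by apply/funext => y; rewrite !mxE.
  exact: differentiable_entry.
apply: (near_eq_differentiable _ dB).1; apply: filterS uA => y uy.
by rewrite /B /invmx uy.
Qed.

Lemma diff_entry m n (A : V -> 'M[R[i]]_(m, n)) x v i j : differentiable A x ->
  'd (fun y => A y i j : R[i]) x v = ('d A x v) i j.
Proof.
move=> dA; apply: diff_cvg_unique; first exact: differentiable_entry.
have cij : {for 'd A x v, continuous (fun N : 'M[R[i]]_(m, n) => N i j : R[i])}.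
  by apply/differentiable_continuous/differentiable_coord.
have := cvg_comp _ _ (diff_cvg_scale (v := v) dA) cij.
apply: cvg_trans; apply: near_eq_cvg; near=> h.
by rewrite /= !mxE.
Unshelve. all: by end_near. Qed.

Lemma diffM_apply (f g : V -> R[i]) x v : differentiable f x -> differentiable g x ->
  'd (fun y => f y * g y : R[i]) x v = 'd f x v * g x + f x * 'd g x v.
Proof.
move=> df dg; apply: diff_cvg_unique; first exact: differentiableM.
have dl := differentiable_line x v 0.
have cg : g (x + h *: v) @[h --> (0 : R[i])^'] --> g x.
  have c0 : {for (0 : R[i]), continuous (fun h : R[i] => g (x + h *: v))}.
    apply: (@continuous_comp _ _ _ (fun h : R[i] => x + h *: v) g).
      exact: differentiable_continuous.
    by rewrite scale0r addr0; exact: differentiable_continuous.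
  apply: cvg_trans (_ : g (x + h *: v) @[h --> (0 : R[i])] --> g x).
    by apply: cvg_app; exact: cvg_within.
  by rewrite -{2}[x]addr0 -(scale0r v); exact: c0.
apply: cvg_trans (cvgD (cvgM (diff_cvg (v := v) df) cg)
  (cvgM (cvg_cst (f x)) (diff_cvg (v := v) dg))).
apply: near_eq_cvg; near=> h.
by rewrite !fctE /cst /=; ring.
Unshelve. all: by end_near. Qed.

Lemma differentiable_exp (f : V -> R[i]) n x : differentiable f x ->
  differentiable (fun y => f y ^+ n : R[i]) x.
Proof.
move=> df; elim: n => [|n ih]; first exact: differentiable_cst.
rewrite (_ : (fun y => _) = (fun y => f y * f y ^+ n)); first exact: differentiableM.
by apply/funext => y; rewrite exprS.
Qed.

Lemma diff_exp (f : V -> R[i]) n x v : differentiable f x ->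
  'd (fun y => f y ^+ n : R[i]) x v = n%:R * f x ^+ n.-1 * 'd f x v.
Proof.
have key (k : nat) (w D : R[i]) :
    D * w ^+ k + w * (k%:R * w ^+ k.-1 * D) = k.+1%:R * w ^+ k * D.
  case: k => [|k]; first by rewrite /= !expr0; ring.
  by rewrite [in RHS]mulrS /= exprS; ring.
move=> df; elim: n => [|n ih].
  rewrite mul0r mul0r; apply: diff_cvg_unique; first exact: differentiable_cst.
  by apply: cvg_near_cst; near=> h; rewrite !expr0 subrr mulr0.
have E : (fun y => f y ^+ n.+1 : R[i]) = (fun y => f y * f y ^+ n : R[i]).
  by apply/funext => y; rewrite exprS.
apply: etrans (congr1 (fun h : V -> R[i] => 'd h x v) E) _.
apply: etrans (diffM_apply v df (differentiable_exp n df)) _.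
exact: etrans (congr1 (fun z => 'd f x v * f x ^+ n + f x * z) ih) (key _ _ _).
Unshelve. all: by end_near. Qed.

End MatrixValued.

Section Near.
Variables (R : realType) (V : normedModType R[i]).

Lemma near_imply (x : V) (P Q : V -> Prop) : (forall y, P y -> Q y) ->
  (\forall y \near x, P y) -> \forall y \near x, Q y.
Proof. by move=> PQ; apply: filterS. Qed.

Lemma near_and (x : V) (P Q : V -> Prop) : (\forall y \near x, P y) ->
  (\forall y \near x, Q y) -> \forall y \near x, P y /\ Q y.
Proof. by move=> xP xQ; apply: filterI. Qed.

Lemma near_continuous (W : normedModType R[i]) (f : V -> W) (x : V) (y : W) (P : W -> Prop) :
  {for x, continuous f} -> f x = y -> (\forall z \near y, P z) ->
  \forall z \near x, P (f z).
Proof. by move=> cf <-; exact: cf. Qed.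

Lemma near_differentiable_comp (W X : normedModType R[i]) (f : V -> W) (g : W -> X) x y :
  f x = y ->
  (\forall z \near x, differentiable f z) -> (\forall z \near y, differentiable g z) ->
  \forall z \near x, differentiable (fun z => g (f z)) z.
Proof.
move=> fxy df dg; have cf : {for x, continuous f}.
  by apply: differentiable_continuous; exact: nbhs_singleton df.
apply: near_imply (near_and df (near_continuous cf fxy dg)) => z [d1 d2].
exact: (@differentiable_comp _ _ _ _ f g).
Qed.

End Near.

Lemma diff_comp_apply (R : realType) (U V W : normedModType R[i]) (f : U -> V) (g : V -> W)
  (x v : U) : differentiable f x -> differentiable g (f x) ->
  'd (fun y => g (f y)) x v = 'd g (f x) ('d f x v).
Proof. by move=> df dg; have := diff_comp df dg; rewrite funeqE => /(_ v). Qed.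

Section Jacobian.
Variables (R : realType) (r : nat).
Local Notation Cr := 'rV[R[i]]_r.
Implicit Types (f g Phi : Cr -> Cr) (x v : Cr).

(** With row vectors this is the transpose of the usual matrix, and composites multiply in the order
    in which the maps are applied. *)
Definition jacobian_mx f x : 'M[R[i]]_r := \matrix_(i, j) ('d f x (delta_mx 0 i)) 0 j.
Local Notation "''J' f x" := (jacobian_mx f x).

Lemma diff_jacobian f x v : 'd f x v = v *m 'J f x.
Proof.
apply/rowP => j; rewrite {1}(row_sum_delta v) linear_sum summxE mxE.
by apply: eq_bigr => i _; rewrite linearZ !mxE.
Qed.

Lemma jacobian_comp f g x : differentiable f x -> differentiable g (f x) ->
  'J (fun y => g (f y) : Cr) x = 'J f x *m 'J g (f x).
Proof.
move=> df dg; apply/row_matrixP => i; rewrite !rowE mulmxA.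
apply: etrans (esym (diff_jacobian (fun y => g (f y)) x _)) _.
apply: etrans _ (congr1 (fun u => u *m jacobian_mx g (f x)) (diff_jacobian f x _)).
apply: etrans _ (diff_jacobian g (f x) _).
exact: (diff_comp_apply (delta_mx 0 i) df dg).
Qed.

Lemma jacobian_entry f x i j : 'J f x i j = 'd f x (delta_mx 0 i) 0 j.
Proof. by rewrite mxE. Qed.

Lemma holomorphic_det_jacobian f x : (\forall y \near x, differentiable f y) ->
  \forall y \near x, differentiable (fun z => \det ('J f z) : R[i]) y.
Proof.
move=> df.
have H i j : \forall y \near x, differentiable (fun z => 'd f z (delta_mx 0 i) 0 j : R[i]) y.
  have dfj : \forall y \near x, differentiable (fun z => f z 0 j : R[i]) y.
    by apply: filterS df => y dy; exact: differentiable_entry.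
  have := holomorphic_diff (delta_mx 0 i) dfj => dd.
  apply: filterS2 dd (near_join df) => y dy dfy.
  apply: (near_eq_differentiable _ dy).1.
  by apply: filterS dfy => z dz; rewrite diff_entry.
have HH : \forall y \near x, forall ij : 'I_r * 'I_r,
    differentiable (fun z => 'd f z (delta_mx 0 ij.1) 0 ij.2 : R[i]) y.
  exact: (@filter_forall _ _
    (fun ij y => differentiable (fun z => 'd f z (delta_mx 0 ij.1) 0 ij.2 : R[i]) y)
    (nbhs x) (nbhs_filter x) (fun ij => H ij.1 ij.2)).
apply: filterS HH => y Hy; apply: differentiable_det => i j.
rewrite (_ : (fun z => _) = (fun z => 'd f z (delta_mx 0 i) 0 j : R[i])); last first.
  by apply/funext => z; rewrite jacobian_entry.
exact: (Hy (i, j)).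
Qed.

(** A form of top degree is determined by its value on the standard basis, so the preservation of
    [Omega] is a single scalar equation involving the Jacobian determinant. *)
Lemma preserves_formP (Omega : Cr -> ('I_r -> Cr) -> R[i]) Phi :
  (\forall x \near (0 : Cr), multilinear (Omega x) /\ Defs.alternating (Omega x)) ->
  Phi 0 = 0 -> {for 0, continuous Phi} ->
  (\forall x \near (0 : Cr), \det ('J Phi x) * Omega (Phi x) (fun k => delta_mx 0 k) =
     Omega x (fun k => delta_mx 0 k)) ->
  preserves_form Omega Phi.
Proof.
move=> mO P0 cP H.
have mOP := near_continuous cP P0 mO.
apply: near_imply (near_and (near_and mO mOP) H) => x [[[m1 a1] [m2 a2]] E].
apply/funext => v; rewrite /pullback (alternating_det _ m2 a2) (alternating_det v m1 a1).
rewrite -E mulrA; congr (_ * _); rewrite -det_mulmx; congr (\det _).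
apply/row_matrixP => k; rewrite row_mul.
have -> : row k (\matrix_(i, j) v i 0 j) = v k by apply/rowP => j; rewrite !mxE.
by rewrite -diff_jacobian; apply/rowP => j; rewrite !mxE.
Qed.

End Jacobian.

(** * Weighted scalings *)

Section WeightedScaling.
Variables (R : realType) (r : nat) (m : 'I_r -> nat).
Local Notation Cr := 'rV[R[i]]_r.
Implicit Types (f : Cr -> R[i]) (x v : Cr) (z : R[i]).
Local Notation M := (\sum_k m k)%N.

Definition scale z x : Cr := \row_k (z ^+ m k * x 0 k).
Definition euler x : Cr := \row_k ((m k)%:R * x 0 k).

Lemma row_norm_lt x (e : R[i]) : 0 < e -> (`|x| < e) <-> forall k, `|x 0 k| < e.
Proof.
move=> e0; have E : (`|x| < e) <-> ball (0 : Cr) e x.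
  by rewrite -ball_normE /= sub0r normrN.
rewrite E; split=> [bx k|xe].
  by have [_ /(_ 0 k)] := bx; rewrite -ball_normE /= mxE sub0r normrN.
by split=> // i k; rewrite -ball_normE /= mxE sub0r normrN ord1.
Qed.

(** The factor z runs over real t in an open interval around [0, 1], for which 2 is a convenient
    bound; 2^M dominates every 2^(m_k). *)
Lemma scale_bound z x (e : R[i]) : `|z| <= 2 -> 0 < e -> `|x| < e ->
  `|scale z x| < 2 ^+ M * e.
Proof.
move=> z2 e0 xe; have e20 : 0 < 2 ^+ M * e by rewrite mulr_gt0 ?exprn_gt0.
apply/(row_norm_lt _ e20) => k; rewrite mxE normrM normrX.
have xk : `|x 0 k| < e by move/(row_norm_lt _ e0): xe.
have zk : `|z| ^+ m k <= 2 ^+ M.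
  rewrite (@le_trans _ _ (2 ^+ m k))//; first by rewrite lerXn2r ?nnegrE.
  by rewrite ler_weXn2l ?ler1n// (bigD1 k)//= leq_addr.
apply: le_lt_trans (ler_wpM2r (normr_ge0 _) zk) _.
by rewrite ltr_pM2l// exprn_gt0.
Qed.

Lemma scale1 x : scale 1 x = x.
Proof. by apply/rowP => k; rewrite mxE expr1n mul1r. Qed.

Lemma scaleM z z' x : scale z (scale z' x) = scale (z * z') x.
Proof. by apply/rowP => k; rewrite !mxE exprMn mulrA. Qed.

Lemma scale0 z : scale z 0 = 0.
Proof. by apply/rowP => k; rewrite !mxE mulr0. Qed.

Lemma euler0 : euler 0 = 0.
Proof. by apply/rowP => k; rewrite !mxE mulr0. Qed.

Lemma differentiable_scale (V : normedModType R[i]) (s : V -> R[i]) (g : V -> Cr) (y : V) :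
  differentiable s y -> differentiable g y -> differentiable (fun w => scale (s w) (g w)) y.
Proof.
move=> ds dg; apply: differentiable_mx => i k.
rewrite (_ : (fun w => _) = (fun w => s w ^+ m k * g w 0 k : R[i])); last first.
  by apply/funext => w; rewrite mxE.
apply: differentiableM; [exact: differentiable_exp | exact: differentiable_entry].
Qed.

Lemma diff_scale_map (V : normedModType R[i]) (s : V -> R[i]) (g : V -> Cr) (y w : V) :
  differentiable s y -> differentiable g y ->
  'd (fun u => scale (s u) (g u)) y w = scale (s y) ('d g y w) +
     \row_k ((m k)%:R * s y ^+ (m k).-1 * 'd s y w * g y 0 k).
Proof.
move=> ds dg; apply/rowP => k.
rewrite -(diff_entry _ 0 k (differentiable_scale ds dg)) !mxE.
have E : (fun u => scale (s u) (g u) 0 k : R[i]) = (fun u => s u ^+ m k * g u 0 k : R[i]).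
  by apply/funext => u; rewrite mxE.
apply: etrans (congr1 (fun h : V -> R[i] => 'd h y w) E) _.
apply: etrans (diffM_apply w (differentiable_exp (m k) ds) (differentiable_entry 0 k dg)) _.
have e1 := diff_exp (m k) w ds; have e2 := diff_entry w 0 k dg.
by rewrite addrC -e1 -e2.
Qed.

Lemma diff_id_apply (V : normedModType R[i]) (x v : V) : 'd (fun y : V => y) x v = v.
Proof. by have [_ ->] := is_diff_id x. Qed.

Lemma diff_cst_apply (V W : normedModType R[i]) (c : W) (x v : V) : 'd (fun _ : V => c) x v = 0.
Proof. by have := diff_cst c x; rewrite funeqE => ->. Qed.

Lemma diff_scale_left z x v : 'd (scale z) x v = scale z v.
Proof.
have did : differentiable (fun y : Cr => y) x by [].
apply: etrans (diff_scale_map v (differentiable_cst z x) did) _.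
rewrite diff_id_apply diff_cst_apply; apply/rowP => k; rewrite !mxE.
by rewrite mulr0 mul0r addr0.
Qed.

(** The derivative in t of t^M f (t^m x) is E + M applied to t^(M-1) f (t^m x) as a function of x.
    Integrating over [0, 1] gives f x, the lower end contributing 0 because M > 0. *)
Lemma euler_primitive f : (0 < M)%N -> (\forall x \near (0 : Cr), differentiable f x) ->
  exists h : Cr -> R[i], (\forall x \near (0 : Cr), differentiable h x) /\
    \forall x \near (0 : Cr), 'd h x (euler x) + M%:R * h x = f x.
Proof.
move=> M0 /near_holo_ball[rho [B [rho0 fB]]].
pose e := rho / 2 ^+ M.
have e0 : 0 < e by rewrite divr_gt0// exprn_gt0.
have sc z x : `|z| <= 2 -> `|x| < e -> `|scale z x - 0| < rho.
  move=> z2 xe; rewrite subr0; have := scale_bound z2 e0 xe.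
  by rewrite /e mulrC divfK// expf_neq0// pnatr_eq0.
have df z x : `|z| <= 2 -> `|x| < e -> differentiable f (scale z x).
  by move=> z2 xe; have [] := fB _ (sc z x z2 xe).
pose F x (t : R) : R[i] := t%:C ^+ M.-1 * f (scale t%:C x).
have t2 (t : R) : t \in `](-1)%R, 2%:R[ -> `|t%:C| <= 2 :> R[i].
  rewrite in_itv /= normr_real_complex -[2]/(2%:R) -(rmorph_nat (real_complex R)) lecR.
  by move=> /andP[t1 t3]; rewrite ler_norml; apply/andP; split; lra.
have dF z x : `|z| <= 2 -> `|x| < e -> differentiable (fun y => f (scale z y)) x.
  move=> z2 xe; apply: (@differentiable_comp _ _ _ _ (scale z) f); last exact: df.
  by apply: differentiable_scale => //; exact: differentiable_cst.
have dG z x n : `|z| <= 2 -> `|x| < e ->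
    differentiable (fun w : R[i] => w ^+ n * f (scale w x) : R[i]) z.
  move=> z2 xe; apply: differentiableM; first exact: differentiable_exp.
  apply: (@differentiable_comp _ _ _ _ (fun w : R[i] => scale w x) f); last exact: df.
  by apply: differentiable_scale => //; exact: differentiable_cst.
have e20 : 0 < e / 2 by rewrite divr_gt0.
have ball_e x0 x : `|x0| < e / 2 -> `|x - x0| < e / 2 -> `|x| < e.
  move=> x0e xe; rewrite -[x](subrK x0) (le_lt_trans (ler_normD _ _))//.
  by rewrite [ltRHS]splitr ltrD.
have key x0 : `|x0| < e / 2 -> differentiable (fun x => cint 0 1 (F x)) x0 /\
    'd (fun x => cint 0 1 (F x)) x0 (euler x0) + M%:R * cint 0 1 (F x0) = f x0.
  move=> x0e.
  have x0e' : `|x0| < e by apply: (ball_e x0) => //; rewrite subrr normr0.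
  have HF (t : R) : t \in `](-1)%R, 2%:R[ ->
      holo_ball (fun x => F x t) x0 (e / 2) (2 ^+ M.-1 * B).
    move=> /t2 tt x /(ball_e _ _ x0e) xe; split.
      by apply: differentiableM; [exact: differentiable_cst | exact: dF].
    rewrite normrM normrX ler_pM ?exprn_ge0 ?lerXn2r ?nnegrE//.
    by have [] := fB _ (sc _ x tt xe).
  have HC x (t : R) : `|x - x0| < e / 2 -> t \in `](-1)%R, 2%:R[ -> {for t, continuous (F x)}.
    move=> /(ball_e _ _ x0e) xe /t2 tt.
    apply: (@continuous_comp _ _ _ (fun t : R => t%:C) (fun w : R[i] => w ^+ M.-1 * f (scale w x) : R[i])).
      exact: continuous_real_complex.
    by apply: differentiable_continuous; exact: dG.
  have m10 : -1 < 0 :> R by rewrite ltrN10.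
  have l12 : 1 < 2%:R :> R by rewrite ltr1n.
  have [d1 d2 d3] := holomorphic_integral m10 ler01 l12 e20 HF HC.
  split; first exact: d1.
  have in01 (t : R) : t \in `[0, 1] -> t \in `](-1)%R, 2%:R[.
    by rewrite !in_itv /= => /andP[? ?]; apply/andP; split; lra.
  have cF : continuous_itv 0 1 (F x0).
    by move=> t /in01; apply: HC; rewrite subrr normr0.
  rewrite d2 -(@cintZ _ _ _ M%:R _ cF) -(cintD (d3 (euler x0)) (@continuous_itvZ _ _ _ M%:R _ cF)).
  pose P z : R[i] := z ^+ M * f (scale z x0).
  have -> : f x0 = P 1 - P 0.
    by rewrite /P expr1n scale1 mul1r expr0n eqn0Ngt M0 mul0r subr0.
  have dP (t : R) : t \in `[0, 1] -> 'd P (t%:C) 1 =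
      'd (fun x => F x t) x0 (euler x0) + M%:R * F x0 t.
    move=> /in01/t2; rewrite /P /F; set z := t%:C => z2.
    have did : differentiable (fun w : R[i] => w) z by [].
    have dsc : differentiable (fun w : R[i] => scale w x0) z.
      by apply: differentiable_scale => //; exact: differentiable_cst.
    have dfs : differentiable (fun w : R[i] => f (scale w x0)) z.
      exact: (@differentiable_comp _ _ _ _ (fun w : R[i] => scale w x0) f _ dsc (df z x0 z2 x0e')).
    (* The derivative of [scale w x0] in w at z. The relation [scale z (euler x0) = z *: W] involves
       no division by z, so it remains valid at the end point t = 0. *)
    pose W : Cr := \row_k ((m k)%:R * z ^+ (m k).-1 * x0 0 k).
    have zW : scale z (euler x0) = z *: W.
      apply/rowP => k; rewrite !mxE; case: (m k) => [|n]; first by ring.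
      by rewrite exprS /=; ring.
    have id1 := @diff_id_apply R[i] z 1.
    have e1 := etrans (diff_exp M (1 : R[i]) did) (congr1 (fun u => M%:R * z ^+ M.-1 * u) id1).
    rewrite mulr1 in e1.
    have dc : differentiable (fun _ : R[i] => x0) z by exact: differentiable_cst.
    have e2 : 'd (fun w : R[i] => scale w x0) z (1 : R[i]) = W.
      apply: etrans (diff_scale_map (1 : R[i]) did dc) _.
      rewrite id1 (@diff_cst_apply R[i] Cr x0 z 1) scale0 add0r; apply/rowP => k.
      by rewrite !mxE mulr1.
    have e3 : 'd (fun w : R[i] => f (scale w x0)) z 1 = 'd f (scale z x0) W.
      apply: etrans (@diff_comp_apply _ _ _ _ (fun w : R[i] => scale w x0) f z 1 dsc (df z x0 z2 x0e')) _.
      exact: (congr1 (fun w => 'd f (scale z x0) w) e2).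
    have dz : differentiable (scale z) x0.
      by apply: differentiable_scale => //; exact: differentiable_cst.
    have e4 : 'd (fun y => f (scale z y)) x0 (euler x0) = z * 'd f (scale z x0) W.
      apply: etrans (@diff_comp_apply _ _ _ _ (scale z) f x0 (euler x0) dz (df z x0 z2 x0e')) _.
      rewrite -diff_scale -zW; congr ('d f _ _); exact: diff_scale_left.
    have e5 : 'd (fun x => z ^+ M.-1 * f (scale z x) : R[i]) x0 (euler x0) =
        z ^+ M.-1 * (z * 'd f (scale z x0) W).
      apply: etrans (diffM_apply (euler x0) (differentiable_cst (z ^+ M.-1) x0) (dF z x0 z2 x0e')) _.
      apply: etrans (congr2 (fun u w => u * f (scale z x0) + z ^+ M.-1 * w)
        (@diff_cst_apply Cr R[i] (z ^+ M.-1) x0 (euler x0)) e4) _.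
      by rewrite mul0r add0r.
    apply: etrans (diffM_apply (1 : R[i]) (differentiable_exp M did) dfs) _.
    apply: etrans (congr2 (fun u w => u * f (scale z x0) + z ^+ M * w) e1 e3) _.
    apply: etrans _ (congr1 (fun u => u + M%:R * (z ^+ M.-1 * f (scale z x0))) (esym e5)).
    have -> : z ^+ M = z * z ^+ M.-1 by rewrite -exprS prednK.
    by move: (f (scale z x0)) ('d f (scale z x0) W) => u w; ring.
  apply: (@cint_FTC _ 0 1 (fun t => P t%:C) _ ler01).
    exact: continuous_itvD (d3 (euler x0)) (@continuous_itvZ _ _ _ M%:R _ cF).
  move=> t t01; rewrite -(dP t t01).
  have dPt : differentiable P (0 + t%:C *: (1 : R[i])).
    by rewrite add0r [_ *: _]mulr1; apply: dG => //; exact/t2/in01.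
  have L (u : R) : u%:C = 0 + u%:C *: (1 : R[i]) by rewrite add0r [_ *: _]mulr1.
  have ReP : (fun u : R => Re (P u%:C)) = (fun u : R => Re (P (0 + u%:C *: (1 : R[i])))).
    by apply/funext => u; rewrite -L.
  have ImP : (fun u : R => Im (P u%:C)) = (fun u : R => Im (P (0 + u%:C *: (1 : R[i])))).
    by apply/funext => u; rewrite -L.
  rewrite (L t) /= ReP ImP.
  by split; [exact: is_derive_Re_line dPt | exact: is_derive_Im_line dPt].
exists (fun x => cint 0 1 (F x)); split; apply/near_normP; exists (e / 2) => // x.
  by rewrite subr0 => /key[].
by rewrite subr0 => /key[].
Qed.

End WeightedScaling.

(** Compare the determinants of the two block triangular factorisations of the same matrix. *)
Lemma det_rank_one (F : comNzRingType) n (c : 'cV[F]_n) (b : 'rV[F]_n) :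
  \det (1%:M + c *m b) = 1 + (b *m c) 0 0.
Proof.
have E : block_mx (1%:M + c *m b) (- c) 0 1%:M *m block_mx 1%:M 0 b (1%:M : 'M_1) =
    block_mx 1%:M 0 b 1%:M *m block_mx 1%:M (- c) 0 (1%:M + b *m c).
  rewrite !mulmx_block !(mulmx0, mul0mx, mulmx1, mul1mx, addr0, add0r).
  rewrite mulNmx mulmxN; congr block_mx; first by rewrite -addrA subrr addr0.
  by rewrite addrCA addNr addr0.
have := congr1 determinant E; rewrite !det_mulmx !det_ublock !det_lblock !det1 !(mulr1, mul1r).
by move=> ->; rewrite det_mx11 !mxE.
Qed.

Section ScalingJacobian.
Variables (R : realType) (r : nat) (m : 'I_r -> nat).
Local Notation Cr := 'rV[R[i]]_r.
Local Notation M := (\sum_k m k)%N.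
Local Notation scale := (scale m).
Local Notation euler := (euler m).

Lemma diff_euler (V : normedModType R[i]) (f : Cr -> V) (x : Cr) :
  'd f x (euler x) = \sum_k ((m k)%:R * x 0 k) *: 'd f x (delta_mx 0 k).
Proof.
rewrite (row_sum_delta (euler x)) linear_sum; apply: eq_bigr => k _.
by rewrite linearZ mxE.
Qed.

(** Differentiating s adds a rank-one term, so the Jacobian matrix is (1 + a b) times the diagonal
    matrix of the s^(m_k), and b a is s^-1 E s. *)
Lemma det_jacobian_scale (s : Cr -> R[i]) (x : Cr) : differentiable s x -> s x != 0 ->
  \det (jacobian_mx (fun y => scale (s y) y) x) =
  s x ^+ M * (1 + (s x)^-1 * 'd s x (euler x)).
Proof.
move=> ds sx0.
pose a : 'cV[R[i]]_r := \col_i 'd s x (delta_mx 0 i).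
pose b : 'rV[R[i]]_r := \row_k ((m k)%:R * x 0 k / s x).
pose D : 'rV[R[i]]_r := \row_k s x ^+ m k.
have did : differentiable (fun y : Cr => y) x by [].
have -> : jacobian_mx (fun y => scale (s y) y) x = (1%:M + a *m b) *m diag_mx D.
  apply/matrixP => i k; rewrite mul_mx_diag !mxE big_ord1 !mxE.
  have := diff_scale_map m (delta_mx 0 i) ds did.
  move=> /(congr1 (fun u : Cr => u 0 k)) E; apply: etrans E _.
  rewrite !mxE; have -> : 'd (fun y : Cr => y) x (delta_mx 0 i) = delta_mx 0 i.
    exact: diff_id_apply.
  rewrite mxE eqxx /= eq_sym mulrDl [s x ^+ m k * _]mulrC; congr (_ + _).
  move: ('d s x (delta_mx 0 i)) => u; case: (m k) => [|n]; first by ring.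
  by rewrite exprS /=; field.
rewrite det_mulmx det_rank_one det_diag mulrC; congr (_ * (1 + _)).
  by under eq_bigr do rewrite mxE; rewrite prodrXr.
rewrite diff_euler mulr_sumr mxE; apply: eq_bigr => k _; rewrite !mxE.
by rewrite -[_ *: _]/(_ * _); ring.
Qed.

(** The factor is the one in [det_jacobian_scale]; this agreement is what lets [scaling_transport]
    close. *)
Lemma diff_scale_euler (s : Cr -> R[i]) (x : Cr) : differentiable s x -> s x != 0 ->
  'd (fun y => scale (s y) y) x (euler x) =
  (1 + (s x)^-1 * 'd s x (euler x)) *: euler (scale (s x) x).
Proof.
move=> ds sx0; have did : differentiable (fun y : Cr => y) x by [].
apply: etrans (diff_scale_map m (euler x) ds did) _.
have -> : 'd (fun y : Cr => y) x (euler x) = euler x by exact: diff_id_apply.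
move: ('d s x (euler x)) => u; apply/rowP => k; rewrite !mxE.
case: (m k) => [|n]; first by ring.
by rewrite exprS /=; field.
Qed.

End ScalingJacobian.

Section Projections.
Variables (R : realType) (r : nat).
Local Notation Cr := 'rV[R[i]]_r.
Local Notation V := (Cr * R[i] : normedModType R[i])%type.

Lemma differentiable_functional (W : normedModType R[i]) (L : W -> R[i]) (K : R[i]) (x : W) :
  0 <= K -> (forall c u v, L (c *: u + v) = c * L u + L v) ->
  (forall v, `|L v| <= K * `|v|) -> differentiable L x.
Proof.
move=> K0 linL LK; apply: (differentiable_littleo K0 linL LK _).1 => e e0.
apply/near_normP; exists 1 => // v _.
have -> : L (x + v) = L x + L v by have := linL 1 x v; rewrite scale1r mul1r.
by rewrite [L x + L v]addrC addrK subrr normr0 mulr_ge0// ltW.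
Qed.

Lemma entry_le_norm (x : Cr) k : `|x 0 k| <= `|x|.
Proof.
rewrite real_leNgt ?normr_real//; apply/negP => H.
have e0 : 0 < `|x 0 k| by apply: le_lt_trans H.
by have := (row_norm_lt x e0).1 H k; rewrite ltxx.
Qed.

Lemma differentiable_fst (p : V) : differentiable (fun q : V => q.1) p.
Proof.
apply: differentiable_mx => i k.
apply: (@differentiable_functional V (fun q => q.1 i k) 1) => //.
  by move=> c u v; rewrite !mxE.
by move=> [u v]; rewrite mul1r ord1 (le_trans (entry_le_norm _ _))//; have := lexx `|((u, v) : V)|; rewrite {1}prod_norm_le => /andP[].
Qed.

Lemma differentiable_snd (p : V) : differentiable (fun q : V => q.2) p.
Proof.
apply: (@differentiable_functional V (fun q => q.2) 1) => //.
by move=> [u v]; rewrite mul1r; have := lexx `|((u, v) : V)|; rewrite {1}prod_norm_le => /andP[].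
Qed.

End Projections.

(** * The scalar equation for the scaling factor *)

Section ScalingEquations.
Variables (R : realType) (r : nat) (m : 'I_r -> nat).
Local Notation Cr := 'rV[R[i]]_r.
Local Notation V := (Cr * R[i] : normedModType R[i])%type.
Local Notation M := (\sum_k m k)%N.
Local Notation scale := (scale m).
Local Notation euler := (euler m).

Lemma near_differentiable_scale_pair (h : Cr -> R[i]) (s0 : R[i]) :
  (\forall x \near (0 : Cr), differentiable h x) ->
  \forall p \near ((0, s0) : V), differentiable (fun p : V => h (scale p.2 p.1)) p.
Proof.
move=> dh; apply: (@near_differentiable_comp _ V Cr R[i] (fun p => scale p.2 p.1) h (0, s0) 0) => //.
  by rewrite scale0.
apply/near_normP; exists 1 => // p _; apply: differentiable_scale.
  exact: differentiable_snd.
exact: differentiable_fst.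
Qed.

(** Serves twice: n = M transports volume forms, and n = 1 with k = 1 inverts scalings. It is
    solvable because the origin is fixed by every scaling, so at x = 0 only the power of s
    varies. *)
Lemma scaling_equation (h k : Cr -> R[i]) (n : nat) (s0 : R[i]) : (0 < n)%N ->
  (\forall x \near (0 : Cr), differentiable h x) ->
  (\forall x \near (0 : Cr), differentiable k x) ->
  h 0 != 0 -> s0 != 0 -> h 0 * s0 ^+ n = k 0 ->
  exists s : Cr -> R[i], [/\ \forall x \near (0 : Cr), differentiable s x, s 0 = s0 &
    \forall x \near (0 : Cr), h (scale (s x) x) * s x ^+ n = k x].
Proof.
move=> n0 dh dk h0 s00 hk.
pose F (p : V) : R[i] := h (scale p.2 p.1) * p.2 ^+ n - k p.1.
have dF : \forall p \near ((0, s0) : V), differentiable F p.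
  have d1 := near_differentiable_scale_pair s0 dh.
  have d2 : \forall p \near ((0, s0) : V), differentiable (fun p : V => k p.1) p.
    apply: (@near_differentiable_comp _ V Cr R[i] (fun p => p.1) k (0, s0) 0) => //.
    by apply/near_normP; exists 1 => // p _; exact: differentiable_fst.
  apply: near_imply (near_and d1 d2) => p [dp1 dp2].
  apply: differentiableB; last exact: dp2.
  apply: differentiableM; first exact: dp1.
  by apply: differentiable_exp; exact: differentiable_snd.
have F0 : F (0, s0) = 0 by rewrite /F /= scale0 hk subrr.
have dF0 : 'd F (0, s0) (0, 1) != 0.
  (* On the line through [(0, s0)] directed by [(0, 1)], [F] reduces to a power. *)
  have E : (fun z : R[i] => F (((0, s0) : V) + z *: ((0, 1) : V))) =
      (fun z : R[i] => h 0 * (z + s0) ^+ n - k 0 : R[i]).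
    apply/funext => z; have -> : ((0, s0) : V) + z *: ((0, 1) : V) = (0, z + s0).
      by rewrite -[LHS]/(0 + z *: 0, s0 + z *: 1) scaler0 addr0 [_ *: 1]mulr1 addrC.
    by rewrite /F /= scale0.
  have did : differentiable (fun z : R[i] => z) (0 + s0) by [].
  have dz := differentiable_shift did.
  have e0 := etrans (@diff_shift _ _ _ s0 0 1 did) (@diff_id_apply _ R[i] (0 + s0) 1).
  have e1 := etrans (diff_exp n (1 : R[i]) dz) (congr1 (fun u => n%:R * (0 + s0) ^+ n.-1 * u) e0).
  have dn := differentiable_exp n dz.
  have dh0 : differentiable (fun=> h 0 : R[i]) (0 : R[i]) by exact: differentiable_cst.
  have dk0 : differentiable (fun=> k 0 : R[i]) (0 : R[i]) by exact: differentiable_cst.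
  have c0 (c : R[i]) := @diff_cst_apply _ R[i] R[i] c 0 1.
  have e2 := etrans (diffM_apply (1 : R[i]) dh0 dn)
    (congr2 (fun u w => u * (0 + s0) ^+ n + h 0 * w) (c0 (h 0)) e1).
  have e3 := etrans (diffB_apply (1 : R[i]) (differentiableM dh0 dn) dk0)
    (congr2 (fun u w => u - w) e2 (c0 (k 0))).
  have e4 := etrans (esym (@diff_line _ V F (0, s0) (0, 1) (nbhs_singleton dF)))
    (congr1 (fun q : R[i] -> R[i] => 'd q 0 (1 : R[i])) E).
  have -> := etrans e4 e3.
  rewrite mul0r add0r subr0 mulr1 add0r.
  by rewrite !mulf_neq0// ?expf_neq0// pnatr_eq0 -lt0n.
have [s [ds s0E sE]] := implicit_function dF F0 dF0.
exists s; split => //; apply: near_imply sE => x /eqP.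
by rewrite /F /= subr_eq0 => /eqP.
Qed.

Lemma near_neq0 (f : Cr -> R[i]) : (\forall x \near (0 : Cr), differentiable f x) ->
  f 0 != 0 -> \forall x \near (0 : Cr), f x != 0.
Proof.
move=> df f0; have cf := differentiable_continuous (nbhs_singleton df).
apply: (near_continuous (P := fun z => z != 0) cf erefl).
apply/near_normP; exists `|f 0|; first by rewrite normr_gt0.
by move=> z; apply: contraTneq => ->; rewrite sub0r normrN ltxx.
Qed.

Lemma scaling_transport (f g : Cr -> R[i]) : (0 < M)%N ->
  (\forall x \near (0 : Cr), differentiable f x) ->
  (\forall x \near (0 : Cr), differentiable g x) ->
  f 0 != 0 -> g 0 != 0 ->
  exists s : Cr -> R[i], [/\ \forall x \near (0 : Cr), differentiable s x, s 0 != 0 &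
    \forall x \near (0 : Cr),
      \det (jacobian_mx (fun y => scale (s y) y) x) * f (scale (s x) x) = g x].
Proof.
move=> M0 df dg f0 g0.
have [hf [dhf hfE]] := euler_primitive M0 df.
have [hg [dhg hgE]] := euler_primitive M0 dg.
(* Read t = s, w = s^M, w' = s^(M-1), c = M, sg = E s, and a, h as E h_f and h_f at [Th x]. On the
   left is det (D Th) f (Th x), on the right E (h_f (Th x) s^M) + M h_f (Th x) s^M. *)
have key (c sg a h w w' t : R[i]) : t != 0 -> w = t * w' ->
    w * (1 + t^-1 * sg) * (a + c * h) =
    (1 + t^-1 * sg) * a * w + h * (c * w' * sg) + c * (h * w).
  by move=> t0 ->; field.
have M0C : M%:R != 0 :> R[i] by rewrite pnatr_eq0 -lt0n.
have at0 (h k : Cr -> R[i]) : (\forall x \near (0 : Cr), 'd h x (euler x) + M%:R * h x = k x) ->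
    M%:R * h 0 = k 0.
  by move=> /nbhs_singleton; rewrite euler0 linear0 add0r.
have hf0 : hf 0 != 0.
  by apply: contraNneq f0 => hf0; rewrite -(at0 _ _ hfE) hf0 mulr0.
have hg0 : hg 0 != 0.
  by apply: contraNneq g0 => hg0; rewrite -(at0 _ _ hgE) hg0 mulr0.
pose s0 : R[i] := M.-root (hg 0 / hf 0).
have s0E : s0 ^+ M = hg 0 / hf 0 by exact: rootCK.
have s00 : s0 != 0.
  have : hg 0 / hf 0 != 0 by rewrite mulf_neq0// invr_neq0.
  by rewrite -s0E expf_eq0 M0.
have hfs0 : hf 0 * s0 ^+ M = hg 0 by rewrite s0E mulrC divfK.
have [s [ds sE0 sE]] := scaling_equation M0 dhf dhg hf0 s00 hfs0.
have sn0 : s 0 != 0 by rewrite sE0.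
exists s; split => //.
pose Th (x : Cr) : Cr := scale (s x) x.
have dTh : \forall x \near (0 : Cr), differentiable Th x.
  by apply: near_imply ds => x dx; apply: differentiable_scale.
have cTh : {for 0, continuous Th}.
  exact: differentiable_continuous (nbhs_singleton dTh).
have Th0 : Th 0 = 0 by exact: scale0.
have N1 := near_and (near_and ds (near_neq0 ds sn0)) (near_and dTh dhg).
have N2 := near_and (near_continuous cTh Th0 dhf) (near_continuous cTh Th0 hfE).
(* The scalar equation is going to be differentiated at x, so it must hold on a neighbourhood of
   x. *)
have N3 := near_and hgE (near_join sE).
apply: near_imply (near_and (near_and N1 N2) N3) => x.
move=> [[[[dsx sx0] [dThx dhgx]] [dhfx hfx]] [hgx nx]].
have dsM := differentiable_exp M dsx.
have dhfTh : differentiable (fun y => hf (Th y)) x.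
  exact: (@differentiable_comp _ _ _ _ Th hf x dThx dhfx).
have e1 : 'd (fun y => hf (Th y)) x (euler x) = (1 + (s x)^-1 * 'd s x (euler x)) * 'd hf (Th x) (euler (Th x)).
  apply: etrans (@diff_comp_apply _ _ _ _ Th hf x (euler x) dThx dhfx) _.
  apply: etrans (congr1 (fun u => 'd hf (Th x) u) (diff_scale_euler m dsx sx0)) _.
  exact: diff_scale.
have e2 := diff_exp M (euler x) dsx.
have e3 := etrans (diffM_apply (euler x) dhfTh dsM)
  (congr2 (fun u w => u * s x ^+ M + hf (Th x) * w) e1 e2).
have e4 := (near_eq_differentiable nx dhgx).2.
have {}e4 := congr1 (fun L : Cr -> R[i] => L (euler x)) e4.
have e5 := etrans (esym e4) e3.
rewrite (det_jacobian_scale m dsx sx0) -hgx -(nbhs_singleton nx).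
apply: etrans _ (congr1 (fun u => u + _) (esym e5)).
rewrite -[scale (s x) x]/(Th x) -hfx.
apply: (key _ _ _ _ _ _ _ sx0).
by rewrite -exprS prednK.
Qed.

(** The inverse is sought among scalings: two of them compose to the identity as soon as their
    factors, taken at the proper points, multiply to 1. *)
Lemma scaling_inverse (s : Cr -> R[i]) :
  (\forall x \near (0 : Cr), differentiable s x) -> s 0 != 0 ->
  exists t : Cr -> R[i], [/\ \forall x \near (0 : Cr), differentiable t x, t 0 != 0 &
    \forall y \near (0 : Cr), scale (s (scale (t y) y)) (scale (t y) y) = y].
Proof.
move=> ds s0.
have d1 : \forall x \near (0 : Cr), differentiable (fun=> 1 : R[i]) x.
  by apply/near_normP; exists 1 => // x _; exact: differentiable_cst.
have is0 : (s 0)^-1 != 0 by rewrite invr_neq0.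
have ss0 : s 0 * (s 0)^-1 ^+ 1 = 1 by rewrite expr1 divff.
have [t [dt t0 tE]] := scaling_equation (isT : (0 < 1)%N) ds d1 s0 is0 ss0.
exists t; split => //; first by rewrite t0 invr_neq0.
by apply: near_imply tE => y; rewrite expr1 scaleM => ->; rewrite scale1.
Qed.

(** A right inverse that has a right inverse in turn is two-sided: from S T = 1 and T U = 1 follows
    S = U, hence T S = 1. *)
Lemma scaling_biholomorphism (s : Cr -> R[i]) :
  (\forall x \near (0 : Cr), differentiable s x) -> s 0 != 0 ->
  biholomorphism_germ (fun x => scale (s x) x).
Proof.
have dsc (t : Cr -> R[i]) : (\forall x \near (0 : Cr), differentiable t x) ->
    holomorphic_germ (fun x => scale (t x) x).
  by apply: near_imply => x dx; apply: differentiable_scale.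
move=> ds s0; have [t [dt t0 tE]] := scaling_inverse ds s0.
have [u [du u0 uE]] := scaling_inverse dt t0.
split; [exact: dsc | exact: scale0 |].
exists (fun x => scale (t x) x); split; [exact: dsc | exact: scale0 | | exact: tE].
have cu : {for 0, continuous (fun x => scale (u x) x)}.
  exact: differentiable_continuous (nbhs_singleton (dsc u du)).
have cu0 := near_continuous cu (scale0 m (u 0)) tE.
apply: near_imply (near_and uE cu0) => x [ux tx].
by rewrite ux in tx; rewrite tx ux.
Qed.

End ScalingEquations.

(** * Volume-preserving equivalence *)

Section Biholomorphisms.
Variables (R : realType) (r : nat).
Local Notation Cr := 'rV[R[i]]_r.
Implicit Types (f g : Cr -> Cr).

Lemma holomorphic_germ_continuous (W : normedModType R[i]) (f : Cr -> W) :
  holomorphic_germ f -> {for 0, continuous f}.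
Proof. by move=> df; exact: differentiable_continuous (nbhs_singleton df). Qed.

Lemma holomorphic_germ_comp (W : normedModType R[i]) (f : Cr -> Cr) (g : Cr -> W) :
  f 0 = 0 -> holomorphic_germ f -> holomorphic_germ g ->
  holomorphic_germ (fun x => g (f x)).
Proof. exact: near_differentiable_comp. Qed.

Lemma biholomorphism_inverse f : biholomorphism_germ f -> exists g,
  [/\ biholomorphism_germ g, \forall x \near (0 : Cr), g (f x) = x &
      \forall x \near (0 : Cr), f (g x) = x].
Proof.
move=> [df f0 [g [dg g0 gf fg]]]; exists g; split => //; split => //.
by exists f.
Qed.

Lemma biholomorphism_comp f g : biholomorphism_germ f -> biholomorphism_germ g ->
  biholomorphism_germ (fun x => g (f x)).
Proof.
move=> [df f0 [f' [df' f'0 f'f ff']]] [dg g0 [g' [dg' g'0 g'g gg']]].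
split; [exact: holomorphic_germ_comp | by rewrite f0 |].
have cf := holomorphic_germ_continuous df.
have cg' := holomorphic_germ_continuous dg'.
exists (fun x => f' (g' x)); split; [exact: holomorphic_germ_comp | by rewrite g'0 | |].
  by apply: near_imply (near_and f'f (near_continuous cf f0 g'g)) => x [e1 ->].
by apply: near_imply (near_and gg' (near_continuous cg' g'0 ff')) => x [e1 ->].
Qed.

Lemma det_jacobian_inverse f g : holomorphic_germ f -> holomorphic_germ g -> f 0 = 0 ->
  (\forall x \near (0 : Cr), g (f x) = x) ->
  \forall x \near (0 : Cr), \det (jacobian_mx f x) * \det (jacobian_mx g (f x)) = 1.
Proof.
move=> df dg f0 gf; have cf := holomorphic_germ_continuous df.
have N := near_and (near_and df (near_continuous cf f0 dg)) (near_join gf).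
apply: near_imply N => x [[dfx dgx] gfx].
have did : differentiable (fun y : Cr => y) x by have [] := is_diff_id x.
have E := (near_eq_differentiable gfx did).2.
have J1 : jacobian_mx (fun y => g (f y)) x = 1%:M.
  apply/matrixP => i j; rewrite mxE.
  apply: etrans (congr1 (fun L : Cr -> Cr => L (delta_mx 0 i) 0 j) E) _.
  apply: etrans (congr1 (fun v : Cr => v 0 j) (@diff_id_apply _ _ x (delta_mx 0 i))) _.
  by rewrite !mxE eqxx eq_sym.
rewrite -det_mulmx; apply: etrans (congr1 determinant _) (det1 _ _).
exact: etrans (esym (jacobian_comp dfx dgx)) J1.
Qed.

End Biholomorphisms.

Section Assembly.
Variables (R : realType) (r n : nat).
Local Notation Cr := 'rV[R[i]]_r.

Lemma volume_form_coefficient (Omega : Cr -> ('I_r -> Cr) -> R[i]) :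
  volume_form_germ Omega -> Omega 0 (fun k => delta_mx 0 k) != 0.
Proof.
move=> [mO _ [v]]; have [m0 a0] := nbhs_singleton mO.
by rewrite (alternating_det v m0 a0); apply: contraNneq => ->; rewrite mulr0.
Qed.

Lemma mul1_neq0 (a b : R[i]) : a * b = 1 -> a != 0.
Proof.
by move=> ab; apply/eqP => a0; move/eqP: ab; rewrite a0 mul0r eq_sym oner_eq0.
Qed.

(* [Th] is to satisfy [Phi^* Omega = Omega] for [Phi = kap \o Th \o eta]; in
   coordinates this compares the densities of [kap^* Omega] and [(eta^-1)^* Omega]. *)
Lemma volume_preserving_scaling (m : 'I_r -> nat) (Omega : Cr -> ('I_r -> Cr) -> R[i])
  (eta kap : Cr -> Cr) : (0 < \sum_k m k)%N -> volume_form_germ Omega ->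
  biholomorphism_germ eta -> biholomorphism_germ kap ->
  exists s : Cr -> R[i], [/\ holomorphic_germ s, s 0 != 0 &
    preserves_form Omega (fun x => kap (scale m (s (eta x)) (eta x)))].
Proof.
move=> M0 vO beta bkap; have [mO hO _] := vO; have O0 := volume_form_coefficient vO.
have [deta eta0 _] := beta; have [dkap kap0 _] := bkap.
have [eta' [[deta' eta'0 _] eta'eta etaeta']] := biholomorphism_inverse beta.
have [kap' [[dkap' kap'0 _] kap'kap kapkap']] := biholomorphism_inverse bkap.
pose f0 x := Omega x (fun k => delta_mx 0 k).
have df0 : holomorphic_germ f0 := hO _.
(* The coefficient of [g^* Omega] on the standard basis. *)
pose density (g : Cr -> Cr) (x : Cr) : R[i] := f0 (g x) * \det (jacobian_mx g x).
have ddensity g : g 0 = 0 -> holomorphic_germ g -> holomorphic_germ (density g).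
  move=> g0 dg; have d1 := holomorphic_germ_comp g0 dg df0.
  apply: near_imply (near_and d1 (holomorphic_det_jacobian dg)) => x [dx1 dx2].
  exact: differentiableM.
have density0 g g' : g 0 = 0 -> holomorphic_germ g -> holomorphic_germ g' ->
    (\forall x \near (0 : Cr), g' (g x) = x) -> density g 0 != 0.
  move=> g0 dg dg' g'g; rewrite /density g0 mulf_neq0//.
  exact: mul1_neq0 (nbhs_singleton (det_jacobian_inverse dg dg' g0 g'g)).
have [s [ds s0 sE]] := scaling_transport M0 (ddensity kap kap0 dkap)
  (ddensity eta' eta'0 deta') (density0 _ _ kap0 dkap dkap' kap'kap)
  (density0 _ _ eta'0 deta' deta etaeta').
(* Here a, b, c are the Jacobians of [eta], [Th] and [kap], d is that of [eta'] at [eta x], and u, w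
   are the coefficients of [Omega] at the image point and at x. *)
have key (a b c d u w : R[i]) : b * (u * c) = w * d -> a * d = 1 -> a * b * c * u = w.
  move=> E ad; rewrite (_ : a * b * c * u = a * (b * (u * c))); last by ring.
  by rewrite E mulrCA ad mulr1.
exists s; split => //.
pose Th y := scale m (s y) y.
have [dTh Th0 _] : biholomorphism_germ Th := scaling_biholomorphism m ds s0.
have ceta := holomorphic_germ_continuous deta.
have dThe := holomorphic_germ_comp eta0 deta dTh.
have The0 : Th (eta 0) = 0 by rewrite eta0.
have dPhi := holomorphic_germ_comp The0 dThe dkap.
apply: (preserves_formP mO); first by rewrite -/(Th _) The0.
  exact: holomorphic_germ_continuous dPhi.
have cThe := holomorphic_germ_continuous dThe.
have N1 := near_and deta (near_continuous ceta eta0 dTh).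
have N2 := near_and (near_continuous cThe The0 dkap) (near_continuous ceta eta0 sE).
have N3 := near_and eta'eta (det_jacobian_inverse deta deta' eta0 eta'eta).
apply: near_imply (near_and (near_and N1 N2) N3) => x.
move=> [[[d1 d2] [d3 E]] [ee J1]].
have dd : differentiable (fun y => Th (eta y)) x.
  exact: (@differentiable_comp _ _ _ _ eta Th x d1 d2).
have -> : jacobian_mx (fun y => kap (scale m (s (eta y)) (eta y))) x =
    jacobian_mx eta x *m jacobian_mx Th (eta x) *m jacobian_mx kap (Th (eta x)).
  apply: etrans (@jacobian_comp _ _ (fun y => Th (eta y)) kap x dd d3) _.
  congr (_ *m _); exact: (@jacobian_comp _ _ eta Th x d1 d2).
rewrite !det_mulmx -/(Th _) -!/(f0 _).
move: E; rewrite /density -/(Th _) ee => E.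
exact: key E J1.
Qed.

End Assembly.

(** * Transport of the congruence and conclusion *)

(** The normal forms at two points p and q differ by the diagonal congruence of [w]. [Z] follows [Y]
    by the inverse of the normalisation at p, the inverse diagonal, and the normalisation at q. *)
Lemma congruence_transfer (F : fieldType) n (Ap Aq Xp Xq Y : 'M[F]_n) (w : 'rV[F]_n) :
  Xp \in unitmx -> (forall i, w 0 i != 0) ->
  (forall i j, (Xq^T *m Aq *m Xq) i j = w 0 i * w 0 j * (Xp^T *m Ap *m Xp) i j) ->
  let Z := Xq *m diag_mx (\row_i (w 0 i)^-1) *m invmx Xp *m Y in
  Y^T *m Ap *m Y = Z^T *m Aq *m Z.
Proof.
move=> uXp w0 H Z; pose Di := diag_mx (\row_i (w 0 i)^-1).
have E : Di *m (Xq^T *m Aq *m Xq) *m Di = Xp^T *m Ap *m Xp.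
  apply/matrixP => i j; rewrite mul_mx_diag mul_diag_mx 2![in LHS]mxE H !mxE.
  by field; rewrite !w0.
have XpV : (invmx Xp)^T *m Xp^T = 1%:M by rewrite -trmx_mul mulmxV// trmx1.
rewrite /Z !trmx_mul tr_diag_mx -/Di.
transitivity (Y^T *m ((invmx Xp)^T *m (Xp^T *m Ap *m Xp) *m invmx Xp) *m Y).
  by rewrite !mulmxA -(mulmxA Y^T (invmx Xp)^T) XpV mulmx1 mulmxK.
by rewrite -E !mulmxA.
Qed.

Lemma differentiable_diag (R : realType) (V : normedModType R[i]) n (w : 'I_n -> V -> R[i]) (x : V) :
  (forall i, differentiable (w i) x) ->
  differentiable (fun y => diag_mx (\row_i w i y)) x.
Proof.
move=> dw; apply: differentiable_mx => i j.
rewrite (_ : (fun y => _) = (fun y => w i y *+ (i == j) : R[i])); last first.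
  by apply/funext => y; rewrite !mxE.
by case: (i == j); [exact: dw | exact: differentiable_cst].
Qed.

Theorem corollary2p15 (R : realType) (r n : nat)
    (Omega : 'rV[R[i]]_r -> ('I_r -> 'rV[R[i]]_r) -> R[i])
    (A B : 'rV[R[i]]_r -> 'M[R[i]]_n) :
  volume_form_germ Omega ->
  map_germ sym_mx A ->
  symmetrically_quasi_homogeneous A ->
  map_germ sym_mx B ->
  G_equivalent A B ->
  volume_preserving_equivalent Omega A B.
Proof.
move=> vO _ [chi [lambda [delta [X [bchi l0 [dX uX] [U nU qh]]]]]] _.
move=> [Psi [Y [bPsi [dY uY] BE]]].
pose m k := (2 * lambda k)%N.
have M0 : (0 < \sum_k m k)%N by rewrite -big_distrr muln_gt0.
have [kap [bkap kapchi chikap]] := biholomorphism_inverse bchi.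
pose eta x := chi (Psi x).
have beta : biholomorphism_germ eta := biholomorphism_comp bPsi bchi.
have [s [ds s0 presO]] := volume_preserving_scaling M0 vO beta bkap.
pose Th y := scale m (s y) y.
have bTh : biholomorphism_germ Th := scaling_biholomorphism m ds s0.
(* In the coordinates [chi], [Phi] is the given [Psi] followed by the scaling. So [Psi x] and
   [Phi x] are related as p and q in the homogeneity condition. *)
pose Phi x := kap (Th (eta x)).
have bThe : biholomorphism_germ (fun x => Th (eta x)) := biholomorphism_comp beta bTh.
have bPhi : biholomorphism_germ Phi := biholomorphism_comp bThe bkap.
have [dPsi Psi0 _] := bPsi; have [deta eta0 _] := beta; have [dPhi Phi0 _] := bPhi.
have [dThe The0 _] := bThe.
pose w i x : R[i] := (s (eta x)) ^+ delta i.
pose Z x := X (Phi x) *m diag_mx (\row_i (w i x)^-1) *m invmx (X (Psi x)) *m Y x.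
have cPsi := holomorphic_germ_continuous dPsi.
have cPhi := holomorphic_germ_continuous dPhi.
have ceta := holomorphic_germ_continuous deta.
have cThe := holomorphic_germ_continuous dThe.
have uXPhi := near_continuous cPhi Phi0 uX.
have uXPsi := near_continuous cPsi Psi0 uX.
have se0 := near_continuous ceta eta0 (near_neq0 ds s0).
have wn0 x i : s (eta x) != 0 -> w i x != 0 by move=> ?; rewrite expf_neq0.
exists Phi, Z; split; last exact: presO.
split; first exact: bPhi.
  split.
    have dse := holomorphic_germ_comp eta0 deta ds.
    have dXPhi := holomorphic_germ_comp Phi0 dPhi dX.
    have dXPsi := holomorphic_germ_comp Psi0 dPsi dX.
    have N1 := near_and (near_and dse se0) (near_and dXPhi dXPsi).
    have N2 := near_and (near_join uXPsi) dY.
    apply: near_imply (near_and N1 N2) => x [[[d1 sx] [d2 d3]] [nx d4]].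
    apply: differentiable_mulmx; last exact: d4.
    apply: differentiable_mulmx; last exact: differentiable_invmx.
    apply: differentiable_mulmx; first exact: d2.
    apply: differentiable_diag => i; apply: differentiableV; last exact: wn0.
    exact: differentiable_exp.
  have N := near_and (near_and se0 uXPhi) (near_and uXPsi uY).
  apply: near_imply N => x [[sx u1] [u2 u3]].
  rewrite /GL_mx /= /Z !unitmx_mul unitmx_inv u1 u2 u3 !andbT /= unitmxE det_diag unitfE.
  by apply/prodf_neq0 => i _; rewrite mxE invr_neq0// wn0.
have N1 := near_and (near_and se0 uXPsi) (near_continuous cThe The0 chikap).
have N2 := near_and (near_continuous cPsi Psi0 nU) (near_continuous cPhi Phi0 nU).
apply: near_imply (near_and (near_and N1 N2) BE) => x.
move=> [[[[sx u2] chiq] [Up Uq]] ->].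
have H i j : ((X (Phi x))^T *m A (Phi x) *m X (Phi x)) i j =
    w i x * w j x * ((X (Psi x))^T *m A (Psi x) *m X (Psi x)) i j.
  (* For odd delta_i + delta_j both entries vanish, so the factor [w i x * w j x] is harmless
     although no integral power of t corresponds to it. *)
  have := qh i j; case: ifPn => [_ B0|ev Bt]; first by rewrite !B0// mulr0.
  (* Taking t = s^2 turns t^(lambda_k) into s^(m_k), and t^((delta_i + delta_j) / 2) into the
     product of s^(delta_i) and s^(delta_j). *)
  rewrite (Bt (s (eta x) ^+ 2) (Psi x) (Phi x) Up Uq); last first.
    by move=> k; rewrite chiq mxE exprM.
  by rewrite -exprM -exprD mul2n (even_halfK ev).
pose W : 'rV[R[i]]_n := \row_i w i x.
have WE : \row_i (W 0 i)^-1 = \row_i (w i x)^-1 by apply/rowP => i; rewrite !mxE.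
rewrite /Z -WE; apply: (congruence_transfer (w := W) (Y x) u2) => [i|i j].
  by rewrite mxE wn0.
by rewrite 2![in RHS]mxE; exact: H.
Qed.
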